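(* Let $\mathcal S=\{S_1,\dots,S_m\}$ be a system of injective contractions of a complete metric space whose attractor $K$ is a self-similar dendrite with finite self-similar boundary $P=\partial K$ and whose $P$-sprout $\Gamma=(W,B,E,\varphi)$ is regular; let $\hat\gamma$ be the main tree of $K$ and $G_T$ the transformation graph of $\Gamma$. Then for each ramification point $x$ of $\hat\gamma$ (that is, $x\in\hat\gamma$ with $\mathrm{Ord}(x,\hat\gamma)\ge3$) which is not contained in $B\cup P$, at least one of the following conditions holds: 1) There is a walk $\omega\in\Omega_Q$, consisting of a finite path followed by the infinite repetition of a cycle of $G_T$, which defines a preperiodic address $\beta=\beta_1\beta_2\ldots$ (the sequence of labels of its edges) with $\pi(\beta)=x$. 2) There is a walk $\omega=(\mathbf e_1,\dots,\mathbf e_k,\mathbf e_b)\in\Omega_B$ with end vertex $b$ such that, for the multiindex $\mathbf j=j_1\dots j_k$ with $j_i=\psi(\mathbf e_i)$, one has $x=S_{\mathbf j}(b)$. 3) There is a walk $\omega=(\mathbf e_1,\dots,\mathbf e_k,\mathbf e_p)\in\Omega_P$ with end vertex $p\in P$ such that, for the multiindex $\mathbf j=j_1\dots j_k$ with $j_i=\psi(\mathbf e_i)$, one has $x=S_{\mathbf j}(p)$. If such a point $x$ has a unique address, then 1) holds and neither 2) nor 3) holds. (If $x$ has several addresses, no restriction is asserted on which of 1)–3) may hold.)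
   Context: The attractor $K$ of $\mathcal S$ is the unique nonempty compact set with $K=\bigcup_{i=1}^m S_i(K)$. Write $I=\{1,\dots,m\}$, $I^*=\bigcup_{n\ge1}I^n$, $S_{\mathbf j}=S_{j_1}\circ\dots\circ S_{j_n}$ (the identity for the empty word), $K_{\mathbf j}=S_{\mathbf j}(K)$. The index map $\pi:I^\infty\to K$ sends $\alpha=\alpha_1\alpha_2\ldots$ to the unique point of $\bigcap_n K_{\alpha_1\dots\alpha_n}$; elements of $\pi^{-1}(x)$ are the addresses of $x$; an address is preperiodic if it is eventually periodic. The critical set is $\mathcal C=\bigcup_{i\ne j}K_i\cap K_j$, and $\partial K$ is the set of all $x\in K$ with $S_{\mathbf i}(x)\in\mathcal C$ for some $\mathbf i\in I^*$. $K$ is a self-similar dendrite if it is a locally connected continuum containing no simple closed curve. The main tree $\hat\gamma$ is the smallest subdendrite of $K$ containing $\partial K$. $\mathrm{Ord}(x,D)$ is the number of connected components of $D\setminus\{x\}$. $P$-sprout of $\mathcal S$ ($P=\partial K$): the edge-labeled bipartite graph $\Gamma=(W,B,E,\varphi)$ with white vertices $W=\{w_1,\dots,w_m\}$ ($w_i$ standing for $K_i$), black vertices $B=\mathcal C\cup P$, an edge $e=(w_i,b)$ exactly when $b\in K_i$, and label $\varphi(e)=S_i^{-1}(b)\in P$. It is a tree. It is regular if every vertex in $W$ and in $B\setminus P$ has degree greater than $1$. For $Q\subseteq P$, $\Gamma_Q$ is the smallest subtree of $\Gamma$ containing $Q$. For $i\in I$, $\phi_i:P\to P$ is defined by $\phi_i(p)=\varphi(e)$,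 where $e$ is the last edge (incident to $w_i$) of the unique path in $\Gamma$ from $p$ to $w_i$. For $\mathbf j=j_1\dots j_k$, $\phi_{\mathbf j}=\phi_{j_k}\circ\dots\circ\phi_{j_1}$ (the identity for the empty word). Transformation graph $G_T$: a digraph with vertex set the disjoint union of $V_Q$, $V_B$, $V_P$, where $V_Q$ is the set of all $Q\subseteq P$ with $\#Q\ge3$ and $Q=\phi_{\mathbf i}(P)$ for some (possibly empty) word $\mathbf i$; $V_B=\{b\in B:\deg(b,\Gamma)\ge3\}$; $V_P=\{p\in P:\deg(p,\Gamma)\ge2\}$. Its edge set is the disjoint union of $E_Q$, $E_B$, $E_P$. For $Q,Q'\in V_Q$ and $i\in I$ with $\phi_i(Q)=Q'$ there is an edge $\mathbf e=(Q,Q')\in E_Q$ with label $\psi(\mathbf e)=i$. For $Q\in V_Q$, $b\in V_B$ there is an (unlabeled) edge $(Q,b)\in E_B$ exactly when $b\notin Q$ and $\deg(b,\Gamma_Q)\ge3$. For $Q\in V_Q$, $p\in V_P$ there is an (unlabeled) edge $(Q,p)\in E_P$ exactly when $p\in Q$ and $\deg(p,\Gamma_Q)\ge2$. A walk is proper if it starts at the vertex $P\in V_Q$ and cannot be extended to a larger walk. $\Omega_Q$ is the set of proper walks all of whose edges are in $E_Q$; $\Omega_B$ (resp. $\Omega_P$) is the set of proper finite walks whose last edge is in $E_B$ (resp. $E_P$), all previous edges (possibly none) being in $E_Q$. *)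

(* Defs.v *)
From Stdlib Require List.
From HB Require Import structures.
From mathcomp Require Import all_boot all_order all_algebra.
From mathcomp Require Import all_classical all_reals all_analysis.

Set Implicit Arguments.
Unset Strict Implicit.
Unset Printing Implicit Defensive.

Import Order.TTheory GRing.Theory Num.Theory.
Import numFieldNormedType.Exports.

Local Open Scope classical_set_scope.
Local Open Scope card_scope.
Local Open Scope ring_scope.

#[short(type="completeMetricType")]
HB.structure Definition CompleteMetric (K : numDomainType) :=
  { T of Complete T & Metric K T }.

(** * Dendrites *)

Section dendrites.
Context {R : realType} {X : metricType R}.
Implicit Types A C D K P : set X.

Definition continuum A := [/\ A !=set0, compact A & connected A].

(* Base of connected relatively open sets at every point. *)
Definition locally_connected A :=
  forall x U, A x -> open U -> U x ->
  exists V, [/\ open V, V x, connected (A `&` V) & A `&` V `<=` U].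

Definition simple_closed_curve C :=
  exists g : R -> X,
    [/\ {within `[0, 1], continuous g}, g 0 = g 1,
        set_inj `[0, 1[ g & g @` `[0, 1] = C].

Definition dendrite A :=
  [/\ continuum A, locally_connected A &
      ~ exists2 C, simple_closed_curve C & C `<=` A].

(* The components of D \ {x}; Ord(x, D) is their number. *)
Definition branches D (x : X) : set (set X) :=
  connected_component (D `\ x) @` (D `\ x).

Definition ramification_point D (x : X) := D x /\ branches D x #>= `I_3.

(* [smallest] is an intersection; inside a dendrite the intersection of
   subdendrites containing a common point is again a subdendrite. *)
Definition main_tree_of K P : set X :=
  smallest [set D | dendrite D /\ D `<=` K] P.

Definition contractive (f : X -> X) :=
  exists2 q : R, 0 <= q < 1 & forall x y, mdist (f x) (f y) <= q * mdist x y.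

End dendrites.

(** * Subtrees of a graph *)

(* T is (the vertex set of) a subgraph, with all the e-edges between its
   vertices.  This loses nothing when the ambient graph is itself a tree, since
   a subtree of a tree is an induced subgraph. *)
Definition is_tree (V : eqType) (e : rel V) (T : set V) :=
  [/\ T !=set0,
      forall u v, T u -> T v ->
        exists s, [/\ path e u s, last u s = v & {in s, forall w, T w}] &
      forall c, ucycle e c -> {in c, forall w, T w} -> (size c <= 2)%N].

(** * Walks, finite or infinite, in a directed multigraph *)

Inductive walk (E : Type) : Type :=
| FinWalk of seq E
| InfWalk of (nat -> E).
Arguments FinWalk {E}.
Arguments InfWalk {E}.

Section walks.
Context {V E : Type} (edge : set E) (src tgt : E -> V).

Fixpoint fin_walk_from (v : V) (s : seq E) : Prop :=
  if s is e :: s' then [/\ edge e, src e = v & fin_walk_from (tgt e) s']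
  else True.

Definition walk_from (v : V) (w : walk E) : Prop :=
  match w with
  | FinWalk s => fin_walk_from v s
  | InfWalk f => src (f 0%N) = v /\
                 forall n, edge (f n) /\ tgt (f n) = src (f n.+1)
  end.

Definition initial_segment (w w' : walk E) : Prop :=
  match w, w' with
  | FinWalk s, FinWalk s' => exists t, s' = s ++ t
  | FinWalk s, InfWalk f => s = mkseq f (size s)
  | InfWalk f, InfWalk g => f = g
  | InfWalk _, FinWalk _ => False
  end.

Definition maximal_walk_from (v : V) (w : walk E) :=
  walk_from v w /\
  forall w', walk_from v w' -> initial_segment w w' -> w' = w.

(* n edges of a path, whose n+1 vertices are distinct, followed by the infinite
   repetition of a cycle of length k, whose k vertices are distinct. *)
Definition path_then_cycle (f : nat -> E) :=
  exists n k, [/\ (0 < k)%N,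
    forall t, (n <= t)%N -> f (t + k)%N = f t,
    set_inj `I_n.+1 (src \o f) &
    set_inj [set t | n <= t < n + k]%N (src \o f)].

End walks.

Definition edges_of {E : Type} (w : walk E) : set E :=
  match w with
  | FinWalk s => [set e | List.In e s]
  | InfWalk f => range f
  end.

(** * Self-similar sets *)

(* Infinite words are indexed from 0 : alpha_{n+1} in the usual notation is
   [alpha n]. *)
Definition preperiodic {A : Type} (alpha : nat -> A) :=
  exists n k, (0 < k)%N /\ forall t, (n <= t)%N -> alpha (t + k)%N = alpha t.

Section self_similar.
Context {R : realType} {X : metricType R} {m : nat}.
Variables (S : 'I_m -> X -> X) (K : set X).

(* The attractor, characterized up to uniqueness, which holds for contractions
   of a complete space. *)
Definition is_attractor :=
  [/\ K !=set0, compact K & K = \bigcup_i (S i @` K)].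

(* S_j = S_{j_1} o ... o S_{j_n} *)
Definition S_word (j : seq 'I_m) (x : X) : X := foldr S x j.

Definition K_word (j : seq 'I_m) : set X := S_word j @` K.

(* pi alpha = x *)
Definition is_address (alpha : nat -> 'I_m) (x : X) :=
  \bigcap_n K_word (mkseq alpha n) = [set x].

Definition critical_set : set X :=
  [set x | exists i j, [/\ i != j, (S i @` K) x & (S j @` K) x]].

Definition boundary : set X :=
  [set x | K x /\ exists2 j : seq 'I_m, j != [::] & critical_set (S_word j x)].

Definition main_tree : set X := main_tree_of K boundary.

(** ** The sprout with respect to the boundary *)

Local Notation P := boundary.

Definition black : set X := critical_set `|` P.

(* [inl i] is the white vertex w_i, [inr b] the black vertex b. *)
Definition sprout_vertex : Type := ('I_m + X)%type.

Definition sprout_vertices : set sprout_vertex :=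
  [set v | if v is inr b then black b else True].

Definition sprout_adj : rel sprout_vertex := fun u v =>
  match u, v with
  | inl i, inr b | inr b, inl i => `[< black b /\ (S i @` K) b >]
  | _, _ => false
  end.

(* The label S_i^{-1}(b) of the edge (w_i, b) (the default value of [xget] is
   irrelevant). *)
Definition sprout_label (i : 'I_m) (b : X) : X :=
  xget b [set q | K q /\ S i q = b].

(* Neighbours of v in the subgraph with vertex set T; the degree of v in this
   subgraph is their number (0 if v is not in T). *)
Definition neighbours (T : set sprout_vertex) (v : sprout_vertex) :
    set sprout_vertex :=
  [set u | [/\ T v, T u & sprout_adj v u]].

Definition sprout_regular :=
  (forall i, neighbours sprout_vertices (inl i) #>= `I_2) /\
  (forall b, black b -> ~ P b ->
     neighbours sprout_vertices (inr b) #>= `I_2).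

(* Gamma_Q *)
Definition sprout_hull (Q : set X) : set sprout_vertex :=
  smallest [set T | is_tree sprout_adj T /\ T `<=` sprout_vertices]
           (inr @` Q).

(* [s] lists the vertices strictly between p and w_i on the path, preceded by p
   itself; thus b is the neighbour of w_i on the path from p. *)
Definition phi (i : 'I_m) (p : X) : X :=
  xget p [set q | exists s b,
    [/\ path sprout_adj (inr p) (rcons s (inl i)),
        uniq (inr p :: rcons s (inl i)),
        last (inr p) s = inr b & q = sprout_label i b]].

(* phi_j = phi_{j_k} o ... o phi_{j_1}: the first letter acts first. *)
Definition phi_word (j : seq 'I_m) (p : X) : X := foldl (fun q i => phi i q) p j.

(** ** The transformation graph *)

Inductive gt_vertex : Type :=
| VQ of set X
| VB of X
| VP of X.

(* [EQ Q i Q'] is the edge from Q to Q' labeled i; parallel edges with distinct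
   labels are distinct. *)
Inductive gt_edge : Type :=
| EQ of set X & 'I_m & set X
| EB of set X & X
| EP of set X & X.

Definition gt_src (e : gt_edge) : gt_vertex :=
  match e with EQ Q _ _ | EB Q _ | EP Q _ => VQ Q end.

Definition gt_tgt (e : gt_edge) : gt_vertex :=
  match e with EQ _ _ Q' => VQ Q' | EB _ b => VB b | EP _ p => VP p end.

Definition gt_label (e : gt_edge) : option 'I_m :=
  if e is EQ _ i _ then Some i else None.

Definition gt_vertices : set gt_vertex := [set v |
  match v with
  | VQ Q => [/\ Q `<=` P, Q #>= `I_3 & exists j, Q = phi_word j @` P]
  | VB b => black b /\ neighbours sprout_vertices (inr b) #>= `I_3
  | VP p => P p /\ neighbours sprout_vertices (inr p) #>= `I_2
  end].

Definition gt_edges : set gt_edge := [set e |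
  gt_vertices (gt_src e) /\ gt_vertices (gt_tgt e) /\
  match e with
  | EQ Q i Q' => phi i @` Q = Q'
  | EB Q b => ~ Q b /\ neighbours (sprout_hull Q) (inr b) #>= `I_3
  | EP Q p => Q p /\ neighbours (sprout_hull Q) (inr p) #>= `I_2
  end].

Definition in_EQ : set gt_edge := [set e | if e is EQ _ _ _ then True else False].
Definition in_EB : set gt_edge := [set e | if e is EB _ _ then True else False].
Definition in_EP : set gt_edge := [set e | if e is EP _ _ then True else False].

(* "Cannot be extended" refers to extensions that still start at P, i.e. at the
   end of the walk. *)
Definition proper_walk (w : walk gt_edge) :=
  gt_vertices (VQ P) /\ maximal_walk_from gt_edges gt_src gt_tgt (VQ P) w.

Definition Omega_Q : set (walk gt_edge) :=
  [set w | proper_walk w /\ edges_of w `<=` in_EQ].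

Definition Omega_last (L : set gt_edge) : set (walk gt_edge) :=
  [set w | proper_walk w /\
    exists s e, [/\ w = FinWalk (rcons s e), edges_of (FinWalk s) `<=` in_EQ
                  & L e]].

Definition Omega_B := Omega_last in_EB.
Definition Omega_P := Omega_last in_EP.

End self_similar.

Arguments gt_vertex {R} X.
Arguments gt_edge {R} X m.

(* Main.v *)
(* The ramification point x is a branch point (a "tripod") of three points of
   P: each component of the main tree without x meets P, because the main tree is
   a union of arcs between points of P.  If y is a branch point of Q inside the
   cell K_i, then S_i^-1(y) is a branch point of phi_i(Q): S_i(phi_i q) is the
   point at which q enters K_i, since distinct cells meet in finitely many points
   and two Peano subcontinua of a dendrite sharing two points share an arc.  The
   only obstruction is that two of the three points of phi_i(Q) coincide, which
   forces y to be black; a suitable choice of i avoids this unless the three points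
   leave y through different cells, and then y has degree at least 3 in Gamma_Q
   (case 2), or y is in Q and has degree at least 2 there (case 3).  If this never
   happens, the sets Q_n repeat.  On the resulting cycle every phi_i is injective,
   and injectivity alone forces every branch point of Q to lie in K_i; hence the
   periodic address obtained from the first repetition is an address of x.

   Two points of a dendrite span a single arc, as two arcs would contain a simple
   closed curve.  For the existence of arcs, a Peano continuum is path connected by
   refinement of discrete chains; Zorn's lemma
   yields a maximal family of loops to be cut out of a path; the resulting monotone
   path is reparametrized injectively by a weighted sum of distances of a dense
   sequence to the part of the path already covered. *)
Require Import Defs.
From HB Require Import structures.
From mathcomp Require Import all_boot all_order all_algebra.
From mathcomp Require Import finmap.
From mathcomp Require Import all_classical all_reals all_analysis.
From mathcomp Require Import zify ring lra.

Set Implicit Arguments.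
Unset Strict Implicit.
Unset Printing Implicit Defensive.

Import Order.TTheory GRing.Theory Num.Theory.
Import numFieldNormedType.Exports.

Local Open Scope classical_set_scope.
Local Open Scope card_scope.
Local Open Scope ring_scope.

(** * Arcs in Peano continua *)

Section paths.
Context {R : realType} {X : metricType R}.
Implicit Types (A C U V : set X) (x y z : X) (e : R).

Lemma mdist_open (x : X) (e : R) : open [set y | mdist x y < e].
Proof.
rewrite openE => y /= xy; apply/metricType_numDomainType.nbhs_mdistP.
exists (e - mdist x y); first by rewrite /= subr_gt0.
by move=> z /= yz; rewrite (le_lt_trans (metric_triangle _ y _))//; lra.
Qed.

Lemma expn_half_lt (e : R) : 0 < e -> exists k, 2^-1 ^+ k < e.
Proof.
move=> e0; have [k _ /(_ k (leqnn k))] := near_infty_natSinv_expn_lt (PosNum e0).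
by rewrite /= => ke; exists k; rewrite exprVn -[X in X < _]mul1r.
Qed.

Lemma mdist_le_half_eq (c : R) x y :
  (forall k, mdist x y <= c * 2^-1 ^+ k) -> x = y.
Proof.
move=> xy; apply: mdist_positivity; apply/eqP; rewrite eq_le mdist_ge0 andbT.
apply/ler_addgt0Pl => e e0; rewrite addr0.
have c0 : 0 <= c by have := le_trans (mdist_ge0 _ _) (xy 0%N); rewrite expr0 mulr1.
have [k ke] := expn_half_lt (divr_gt0 e0 (ltr_wpDl c0 ltr01)).
rewrite (le_trans (xy k))// (le_trans _ (ltW (_ : (c + 1) * 2^-1 ^+ k < _)))//.
  by rewrite ler_wpM2r ?exprn_ge0// lerDl.
by rewrite mulrC -ltr_pdivlMr// ltr_wpDl.
Qed.

(** One link of a discrete chain. Besides the distance bound it records a connected subset of A,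
    inside which the link can later be subdivided into finer links. *)
Definition conn_within A e x y := exists C,
  [/\ C `<=` A, connected C, C x, C y & forall u v, C u -> C v -> mdist u v <= e].

Lemma conn_within_refl A e x : 0 <= e -> A x -> conn_within A e x x.
Proof.
move=> e0 Ax; exists [set x]; split => //; [by move=> _ ->|exact: connected1|].
by move=> _ _ -> ->; rewrite mdistxx.
Qed.

(** Local connectedness covers C by open sets V whose traces A [&] V are connected and small. Two
    points of C in the same V are one link apart, so the points reachable from x form a relatively
    clopen subset of C. The points of the chain stay in C; the links are only required to stay in
    A. *)
Lemma connected_chain A C e x y : locally_connected A -> C `<=` A ->
  connected C -> 0 < e -> C x -> C y ->
  exists (c : nat -> X) n, [/\ c 0%N = x, forall k, (n <= k)%N -> c k = y,
    forall k, C (c k) & forall k, conn_within A e (c k) (c k.+1)].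
Proof.
move=> lcA CA connC e0 Cx Cy.
pose chain z := exists (c : nat -> X) n, [/\ c 0%N = x,
  forall k, (n <= k)%N -> c k = z,
  forall k, C (c k) & forall k, conn_within A e (c k) (c k.+1)].
pose small V := [/\ open V, connected (A `&` V) &
  forall u v, V u -> A u -> V v -> A v -> mdist u v <= e].
have smallP z : A z -> exists2 V, small V & V z.
  move=> Az; have zz : [set y | mdist z y < e / 2] z.
    by rewrite /= mdistxx; lra.
  have [V [oV Vz cV Vs]] := lcA _ _ Az (mdist_open z (e / 2)) zz.
  exists V => //; split=> // u v Vu Au Vv Av.
  rewrite (le_trans (metric_triangle _ z _))//.
  have /= zu := Vs u (conj Au Vu); have /= zv := Vs v (conj Av Vv).
  by rewrite metric_sym; lra.
have step z w V : small V -> V z -> V w -> C z -> C w -> chain z -> chain w.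
  move=> [oV cV Ve] Vz Vw Cz Cw [c [n [c0 cn cC cc]]].
  exists (fun k => if (k <= n)%N then c k else w), n.+1; split=> //.
  - by move=> k nk; rewrite leqNgt nk.
  - by move=> k; case: ifP.
  - move=> k; case: (ltngtP k n) => kn; first exact: cc.
      by apply: conn_within_refl; [exact: ltW|exact: CA].
    rewrite kn (cn n)//; exists (A `&` V); split=> //.
      by split=> //; exact: CA.
      by split=> //; exact: CA.
    by move=> u v [? ?] [? ?]; exact: Ve.
suff : [set z | C z /\ chain z] = C by move=> E; have [] : [set z | C z /\ chain z] y by rewrite E.
apply: connC.
- exists x; split=> //; exists (fun=> x), 0%N; split=> // _.
  by apply: conn_within_refl; [exact: ltW|exact: CA].
- exists (\bigcup_(V in [set V | small V /\ exists z, [/\ V z, C z & chain z]]) V).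
    by apply: bigcup_open => V [[]].
  apply/seteqP; split=> z /=.
    move=> [Cz chz]; split=> //; have [V sV Vz] := smallP _ (CA _ Cz).
    by exists V => //; split=> //; exists z.
  by move=> [Cz [V [sV [w [Vw Cw chw]]] Vz]]; split=> //; exact: (step w z V).
- exists (~` \bigcup_(V in [set V | small V /\ exists z, [/\ V z, C z & ~ chain z]]) V).
    by apply: open_closedC; apply: bigcup_open => V [[]].
  apply/seteqP; split=> z /=.
    move=> [Cz chz]; split=> // -[V [sV [w [Vw Cw chw]]] Vz]; apply: chw.
    exact: (step z w V).
  move=> [Cz nz]; split=> //; apply: contrapT => chz; apply: nz.
  have [V sV Vz] := smallP _ (CA _ Cz).
  by exists V => //; split=> //; exists z.
Qed.

(** The constant tail from N on allows evaluation at the truncation of t * N for every real t. *)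
Definition discrete_path A p q e (N : nat) (s : nat -> X) :=
  [/\ s 0%N = p, (0 < N)%N, forall k, (N <= k)%N -> s k = q, forall k, A (s k) &
      forall k, conn_within A e (s k) (s k.+1)].

(** Each link is subdivided inside its own connected set, so the new points stay within e of the old
    ones. A common number M of subdivisions makes the new index k correspond to the old index k %/
    M. *)
Lemma discrete_path_refine A p q e e' N s : locally_connected A ->
  0 < e' -> discrete_path A p q e N s ->
  exists M s', [/\ (0 < M)%N, discrete_path A p q e' (N * M)%N s' &
    forall k, mdist (s (k %/ M)%N) (s' k) <= e].
Proof.
move=> lcA e'0 [s0 N0 sN sA ss].
have /choice[cn cnP] : forall i, exists cn : (nat -> X) * nat,
   [/\ cn.1 0%N = s i, forall k, (cn.2 <= k)%N -> cn.1 k = s i.+1,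
    forall k, A (cn.1 k) /\ mdist (s i) (cn.1 k) <= e
    & forall k, conn_within A e' (cn.1 k) (cn.1 k.+1)].
  move=> i; have [C [CA cC Ci Ci1 Ce]] := ss i.
  have [c [n [c0 cn cC' cc]]] := connected_chain lcA CA cC e'0 Ci Ci1.
  by exists (c, n); split=> //= k; split; [exact: CA|exact: Ce].
(* The successor makes M positive, while the last index M - 1 of a block still reaches the end of
   the longest chain; shorter chains are padded by their end point. *)
pose M := (\max_(i < N) (cn i).2).+1.
exists M, (fun k => if (k %/ M < N)%N then (cn (k %/ M)%N).1 (k %% M)%N else q).
have Aq : A q by rewrite -(sN N).
have e0 : 0 <= e.
  by have [C [_ _ C0 C1 /(_ _ _ C0 C1)]] := ss 0%N; apply: le_trans; exact: mdist_ge0.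
split=> //; last first.
  move=> k; case: ifPn => kN; first by have [_ _ /(_ (k %% M)%N)[]] := cnP (k %/ M)%N.
  by rewrite sN ?mdistxx// leqNgt.
split=> //.
- by rewrite div0n N0 mod0n; have [->] := cnP 0%N.
- by rewrite muln_gt0 N0.
- by move=> k; rewrite -leq_divRL// leqNgt => /negPf ->.
- move=> k; case: ifP => // _.
  by have [_ _ /(_ (k %% M)%N)[]] := cnP (k %/ M)%N.
- move=> k; have := divn_eq k M; set a := (k %/ M)%N; set b := (k %% M)%N => kE.
  have bM : (b < M)%N by rewrite ltn_mod.
  have [b1M|] := ltnP b.+1 M.
    have -> : (k.+1 %/ M = a)%N by rewrite kE -addnS divnMDl// divn_small// addn0.
    have -> : (k.+1 %% M = b.+1)%N by rewrite kE -addnS modnMDl modn_small.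
    case: ifP => aN; first by have [_ _ _] := cnP a; exact.
    by apply: conn_within_refl => //; exact: ltW.
  move=> Mb; have {Mb} bE : b = M.-1 by apply/eqP; rewrite eqn_leq -ltnS bM.
  have k1 : (k.+1 = a.+1 * M + 0)%N by rewrite kE bE mulSn /M/=; lia.
  have -> : (k.+1 %/ M = a.+1)%N by rewrite k1 divnMDl// div0n addn0.
  have -> : (k.+1 %% M = 0)%N by rewrite k1 modnMDl mod0n.
  have [aN|aN] := ltnP a N; last first.
    rewrite ltnNge (leq_trans aN)//=; apply: conn_within_refl => //; exact: ltW.
  have -> : (cn a).1 b = s a.+1.
    have [_ + _ _] := cnP a; apply; rewrite bE /M /=.
    exact: (leq_bigmax (Ordinal aN)).
  case: ifPn => a1N.
    by have [-> _ _ _] := cnP a.+1; apply: conn_within_refl => //; exact: ltW.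
  rewrite sN; last by rewrite leqNgt.
  by apply: conn_within_refl => //; exact: ltW.
Qed.

Definition ucont (f : R -> X) := forall e, 0 < e ->
  exists2 d, 0 < d & forall s t, `|s - t| < d -> mdist (f s) (f t) < e.

Lemma truncnM_divn (a : R) (M : nat) : (0 < M)%N ->
  (Num.truncn (a * M%:R) %/ M)%N = Num.truncn a.
Proof.
move=> M0; have M0' : 0 < M%:R :> R by rewrite ltr0n.
have [a0|a0] := leP 0 a; last first.
  have tr0 (b : R) : b < 0 -> Num.truncn b = 0%N.
    by move=> b0; apply/truncn0Pn; rewrite -ltNge; lra.
  by rewrite !tr0// ?div0n// nmulr_rlt0.
have aM0 : 0 <= a * M%:R by rewrite mulr_ge0 ?ler0n.
apply/esym/eqP; rewrite truncn_eq//; apply/andP; split.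
  rewrite -(ler_pM2r M0') -natrM; apply: le_trans (_ : (Num.truncn (a * M%:R))%:R <= _).
    by rewrite ler_nat leq_divM.
  by rewrite truncn_le.
rewrite -(ltr_pM2r M0') -natrM; apply: lt_le_trans (truncnS_gt _) _.
by rewrite ler_nat; exact: ltn_ceil.
Qed.

Lemma truncn_close (a b : R) : a <= b -> b < a + 1 ->
  Num.truncn b = Num.truncn a \/ Num.truncn b = (Num.truncn a).+1.
Proof.
move=> ab ba; have := le_truncn ab.
suff : (Num.truncn b <= (Num.truncn a).+1)%N by lia.
rewrite truncn_le_nat (lt_trans ba)// -[X in _ < X]natr1 ltrD2r.
exact: truncnS_gt.
Qed.

(** The path is the limit of the step functions sending t to the point of index truncn (t * N_k) of
    the k-th refinement. As N_k divides N_{k+1}, successive step functions differ by at most 2^-k.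
    Compactness of A supplies a cluster point, which the Cauchy bound turns into a limit. *)
Lemma peano_path A p q : compact A -> connected A -> locally_connected A ->
  A p -> A q ->
  exists f : R -> X, [/\ ucont f, f 0 = p, f 1 = q & forall t, A (f t)].
Proof.
move=> cA connA lcA Ap Aq.
pose ep k : R := 2^-1 ^+ k.
have ep0 k : 0 < ep k by rewrite exprn_gt0.
pose good k (st : nat * (nat -> X)) := discrete_path A p q (ep k) st.1 st.2.
have [st0 st0P] : exists st, good 0%N st.
  have [c [n [c0 cn cA' cc]]] := connected_chain lcA (@subset_refl _ A) connA (ep0 0%N) Ap Aq.
  by exists (n.+1, c); split=> //= k /ltnW; exact: cn.
pose next (k : nat) (st st' : nat * (nat -> X)) := good k st -> good k.+1 st' /\
  exists M, [/\ (0 < M)%N, st'.1 = (st.1 * M)%N &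
     forall i, mdist (st.2 (i %/ M)%N) (st'.2 i) <= ep k].
have /choice[nx nxP] : forall kst, exists st', next kst.1 kst.2 st'.
  move=> [k st] /=; have [gst|ngst] := pselect (good k st); last by exists st.
  have [M [s' [M0 s'P ss']]] := discrete_path_refine lcA (ep0 k.+1) gst.
  by exists ((st.1 * M)%N, s') => _; split=> //; exists M.
pose st := fix st k := if k is k'.+1 then nx (k', st k') else st0.
have stP k : good k (st k).
  by elim: k => //= k IHk; have [] := nxP (k, st k) IHk.
have stM k : exists M, [/\ (0 < M)%N, (st k.+1).1 = ((st k).1 * M)%N &
     forall i, mdist ((st k).2 (i %/ M)%N) ((st k.+1).2 i) <= ep k].
  by have [_] := nxP (k, st k) (stP k).
pose u (t : R) k := (st k).2 (Num.truncn (t * (st k).1%:R)).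
have uA t k : A (u t k) by have [_ _ _ + _] := stP k; exact.
have u1 t k : mdist (u t k) (u t k.+1) <= ep k.
  have [M [M0 NE sM]] := stM k.
  by have := sM (Num.truncn (t * (st k.+1).1%:R)); rewrite {1}NE natrM mulrA truncnM_divn.
have ucauchy t k j : mdist (u t k) (u t (k + j)%N) <= 2 * ep k - 2 * ep (k + j)%N.
  elim: j => [|j IHj]; first by rewrite addn0 mdistxx subrr.
  rewrite addnS (le_trans (metric_triangle _ (u t (k + j)%N) _))//.
  have := u1 t (k + j)%N.
  have -> : ep (k + j).+1 = ep (k + j)%N / 2 by rewrite /ep exprSr.
  by lra.
have /choice[f fP] : forall t, exists l, A l /\ forall k, mdist (u t k) l <= 2 * ep k.
  move=> t; have uAoo : (u t @ \oo) A by exists 0%N => // k _ /=; exact: uA.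
  have [l [Al lcl]] := cA (u t @ \oo) _ uAoo.
  exists l; split=> // k; apply/ler_addgt0Pl => e e0.
  have nbl : nbhs l [set y | mdist l y < e].
    by apply: open_nbhs_nbhs; split; [exact: mdist_open|rewrite /= mdistxx].
  have [|z [[j /= kj <-] /= lu]] := lcl [set u t j | j in [set j | (k <= j)%N]] _ _ nbl.
    by exists k => //= j kj; exists j.
  rewrite (le_trans (metric_triangle _ (u t j) _))// [leRHS]addrC lerD//.
    by have := ucauchy t k (j - k)%N; rewrite subnKC//; have := ep0 j; lra.
  by rewrite metric_sym ltW.
exists f; split.
(* Times less than 1/N_k apart have equal or consecutive indices. The error is 2^-k for this one
   link and 2 * 2^-k at each end for the passage to the limit, five times 2^-k in all. *)
- move=> e e0; have [k ke] := @expn_half_lt (e / 5) ltac:(lra).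
  have [_ N0 _ _ ss] := stP k.
  have N0' : 0 < (st k).1%:R :> R by rewrite ltr0n.
  have close s t : s <= t -> t - s < (st k).1%:R^-1 -> mdist (f s) (f t) < e.
    move=> lest tsN.
    have uu : mdist (u s k) (u t k) <= ep k.
      rewrite /u; have [||->|->] := @truncn_close (s * (st k).1%:R) (t * (st k).1%:R).
      - by rewrite ler_pM2r.
      - rewrite -ltrBlDl -mulrBl -ltr_pdivlMr//; first by rewrite mul1r.
      - by rewrite mdistxx ltW.
      - by have [C [_ _ C1 C2 /(_ _ _ C1 C2)]] := ss (Num.truncn (s * (st k).1%:R)).
    have [_ /(_ k) fs] := fP s; have [_ /(_ k) ft] := fP t.
    have := metric_triangle (f s) (u s k) (f t).
    have := metric_triangle (u s k) (u t k) (f t).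
    rewrite (metric_sym (f s) (u s k)).
    have : ep k < e / 5 by [].
    by lra.
  exists (st k).1%:R^-1; first by rewrite invr_gt0.
  move=> s t st'; have [st2|st2] := leP s t.
    by apply: close => //; move: st'; rewrite distrC ger0_norm// subr_ge0.
  rewrite metric_sym; apply: close; first exact: ltW.
  by move: st'; rewrite gtr0_norm// subr_gt0.
- apply/esym; apply: (@mdist_le_half_eq 2) => k; have [_ /(_ k)] := fP 0.
  rewrite /u mul0r truncn0; have [-> _ _ _ _] := stP k; exact.
- apply/esym; apply: (@mdist_le_half_eq 2) => k; have [_ /(_ k)] := fP 1.
  rewrite /u mul1r natrK; have [_ _ sN _ _] := stP k; rewrite sN//.
- by move=> t; have [] := fP t.
Qed.
End paths.

(** * Cutting loops out of a path until its fibres are intervals *)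

Section monotone_paths.
Context {R : realType} {X : metricType R}.
Implicit Types (G : set R) (a b s t u : R).

Lemma mdist_small_eq (x y : X) : (forall e : R, 0 < e -> mdist x y < 2 * e) -> x = y.
Proof.
move=> xy; apply: mdist_positivity; apply/eqP; rewrite eq_le mdist_ge0 andbT.
apply/ler_addgt0Pl => e e0; rewrite addr0.
by have := xy (e / 2) ltac:(lra); lra.
Qed.

(* A loop ]a, b[ of g which is collapsed when passing to an injective path. *)
Definition gap (g : R -> X) G t a b :=
  [/\ a < t < b, 0 <= a /\ b <= 1, forall u, a < u < b -> G u, ~ G a /\ ~ G b
    & g a = g b].

(** An end of the larger gap inside the smaller one would belong to G. With G = G' this says that
    the gap of a point is unique. *)
Lemma gap_sub (g : R -> X) G G' t a b a' b' : G `<=` G' ->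
  gap g G t a b -> gap g G' t a' b' -> a' <= a /\ b <= b'.
Proof.
move=> GG' [/andP[lat ltb] _ abG _ _] [/andP[lat' ltb'] _ _ [Ga' Gb'] _].
split.
  rewrite leNgt; apply/negP => aa'; apply: Ga'; apply: GG'; apply: abG.
  by rewrite aa'/= (lt_trans lat').
rewrite leNgt; apply/negP => bb'; apply: Gb'; apply: GG'; apply: abG.
by rewrite bb' andbT (lt_trans lat).
Qed.

Lemma gap_shift (g : R -> X) G t a b u : gap g G t a b -> a < u < b ->
  gap g G u a b.
Proof. by case. Qed.

Definition gapped (g : R -> X) G := forall t, G t -> exists a b, gap g G t a b.

(** Along the chain the gaps of t are nested, and the gap of t in the union runs from the infimum of
    their left ends to the supremum of their right ends. Continuity of g carries the equality of the
    end values to the limit. *)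
Lemma gapped_bigcup (g : R -> X) (F : set (set R)) : ucont g ->
  F `<=` gapped g -> total_on F subset -> gapped g (\bigcup_(G in F) G).
Proof.
move=> ug Fg Ftot t [G0 FG0 G0t].
pose gp a b := exists2 G, F G & gap g G t a b.
pose As := [set a | exists b, gp a b].
pose Bs := [set b | exists a, gp a b].
have [a0 [b0 gap0]] := Fg _ FG0 _ G0t.
have As0 : As a0 by exists b0, G0.
have Bs0 : Bs b0 by exists a0, G0.
have larger a b a' b' : gp a b -> gp a' b' ->
    exists a'' b'', [/\ gp a'' b'', a'' <= a, a'' <= a', b <= b'' & b' <= b''].
  move=> [G FG Gab] [G' FG' G'ab].
  have [GG'|G'G] := Ftot _ _ FG FG'.
    have [? ?] := gap_sub GG' Gab G'ab.
    by exists a', b'; split=> //; exists G'.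
  have [? ?] := gap_sub G'G G'ab Gab.
  by exists a, b; split=> //; exists G.
have lbA : lbound As 0 by move=> a [b [G _ [_ [? _] _ _ _]]].
have ubB : ubound Bs 1 by move=> b [a [G _ [_ [_ ?] _ _ _]]].
have hiA : has_inf As by split; [exists a0|exists 0].
have hsB : has_sup Bs by split; [exists b0|exists 1].
have infA a : As a -> inf As <= a by move=> Aa; exact: ge_inf hiA.2 _ Aa.
have supB b : Bs b -> b <= sup Bs by move=> Bb; exact: ub_le_sup hsB.2 _ Bb.
have gp_lt a b : gp a b -> a < t < b by move=> [G _ []].
have := gp_lt a0 b0 (ex_intro2 _ _ G0 FG0 gap0) => /andP[a0t tb0].
exists (inf As), (sup Bs); split.
- by rewrite (le_lt_trans (infA _ As0))//= (lt_le_trans tb0)// supB.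
- by split; [exact: lb_le_inf hiA.1 lbA|exact: ge_sup hsB.1 ubB].
- move=> u /andP[au ub]; have [ut|tu|->] := ltgtP u t; last by exists G0.
    have [a [b [G FG gG]] /= au'] := inf_lt hiA.1 au.
    exists G => //; have [/andP[_ tb] _ + _ _] := gG; apply.
    by rewrite au' (lt_trans ut).
  have [b [a [G FG gG]] /= ub'] := sup_gt hsB.1 ub.
  exists G => //; have [/andP[at_ _] _ + _ _] := gG; apply.
  by rewrite ub' (lt_trans at_).
(* If the infimum were in G1, its gap ]c, d[ in G1 would contain left ends of gaps of t arbitrarily
   close to the infimum. Comparing in the larger of two members of the chain, such an end would lie
   in the set whose gap it bounds. The supremum is treated symmetrically. *)
- split=> -[G1 FG1].
    move=> /(Fg _ FG1)[c [d [/andP[ca ad] _ cdG _ _]]].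
    have [a [b [G2 FG2 gG2]] /= aad] := inf_lt hiA.1 ad.
    suff [G3 [FG3 G13 [a3 [b3 [gap3 a3a]]]]] : exists G3, [/\ F G3, G1 `<=` G3 &
        exists a3 b3, gap g G3 t a3 b3 /\ a3 <= a].
      have [_ _ _ [+ _] _] := gap3; apply; apply: G13; apply: cdG.
      rewrite (lt_le_trans ca) ?infA//=; last by exists b3, G3.
      exact: le_lt_trans aad.
    have [G12|G21] := Ftot _ _ FG1 FG2; first by exists G2; split=> //; exists a, b.
    have [_ _ _ _ _] := gG2.
    have [a3 [b3 gap3]] : exists a3 b3, gap g G1 t a3 b3.
      by apply: Fg => //; apply: G21; have [? _ + _ _] := gG2; apply.
    exists G1; split=> //; exists a3, b3; split=> //.
    by have [] := gap_sub G21 gG2 gap3.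
  move=> /(Fg _ FG1)[c [d [/andP[ca ad] _ cdG _ _]]].
  have [b [a [G2 FG2 gG2]] /= aad] := sup_gt hsB.1 ca.
  suff [G3 [FG3 G13 [a3 [b3 [gap3 a3a]]]]] : exists G3, [/\ F G3, G1 `<=` G3 &
      exists a3 b3, gap g G3 t a3 b3 /\ b <= b3].
    have [_ _ _ [_ +] _] := gap3; apply; apply: G13; apply: cdG.
    rewrite (lt_le_trans aad)//= (le_lt_trans _ ad)// supB//.
    by exists a3, G3.
  have [G12|G21] := Ftot _ _ FG1 FG2; first by exists G2; split=> //; exists a, b.
  have [a3 [b3 gap3]] : exists a3 b3, gap g G1 t a3 b3.
    by apply: Fg => //; apply: G21; have [? _ + _ _] := gG2; apply.
  exists G1; split=> //; exists a3, b3; split=> //.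
  by have [] := gap_sub G21 gG2 gap3.
- apply: mdist_small_eq => e e0; have [d d0 gd] := ug _ e0.
  have ltA : inf As < inf As + d by lra.
  have ltB : sup Bs - d < sup Bs by lra.
  have [a [b gpab] aa] := inf_lt hiA.1 ltA.
  have [b' [a' gpab'] bb] := sup_gt hsB.1 ltB.
  have [a3 [b3 [gp3 a3a _ _ b3b]]] := larger _ _ _ _ gpab gpab'.
  have Aa3 : As a3 by exists b3.
  have Bb3 : Bs b3 by exists a3.
  have := infA _ Aa3; have := supB _ Bb3 => b3s a3i.
  have gE : g a3 = g b3 by have [G _ []] := gp3.
  have h1 : mdist (g (inf As)) (g a3) < e.
    by apply: gd; rewrite ltr_distlC; lra.
  have h2 : mdist (g b3) (g (sup Bs)) < e.
    by apply: gd; rewrite ltr_distlC; lra.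
  by rewrite (le_lt_trans (metric_triangle _ (g a3) _))// {2}gE; lra.
Qed.

(** Adjoining ]s, t[ to a maximal G keeps it gapped: a gap with an end inside ]s, t[ lies within
    [s, t] and is absorbed, and any other gap keeps both ends. *)
Lemma gapped_maximal (g : R -> X) : ucont g -> exists G, gapped g G /\
  forall s t, 0 <= s -> s < t -> t <= 1 -> ~ G s -> ~ G t -> g s = g t ->
  forall u, s < u < t -> G u.
Proof.
move=> ug; have [F Fg Ft|G [gG Gmax]] := @Zorn_bigcup _ (gapped g).
  exact: gapped_bigcup.
exists G; split=> // s t s0 st t1 Gs Gt gst u sut; apply: contrapT => Gu.
apply: (Gmax (G `|` [set v | s < v < t])).
  by split=> [v|/(_ u)]; [left|move=> /(_ (or_intror sut))].
move=> v [Gv|/= svt]; last first.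
  exists s, t; split=> //; first by move=> w swt; right.
  by split=> -[]//=; rewrite ltxx ?andbF.
have [a [b [/andP[av vb] [a0 b1] abG [Ga Gb] gab]]] := gG _ Gv.
have [sat|nsat] := boolP (s < a < t).
  have btle : b <= t.
    rewrite leNgt; apply/negP => tb; apply: Gt; apply: abG; lra.
  exists s, t; split=> //; [lra|by move=> w swt; right|].
  by split=> -[]//=; rewrite ltxx ?andbF.
have [sbt|nsbt] := boolP (s < b < t).
  have btle : s <= a.
    rewrite leNgt; apply/negP => tb; apply: Gs; apply: abG; lra.
  exists s, t; split=> //; [lra|by move=> w swt; right|].
  by split=> -[]//=; rewrite ltxx ?andbF.
exists a, b; split=> //; first by rewrite av.
  by move=> w wab; left; exact: abG.
by split=> -[]//=; exact/negP.
Qed.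

(** Monotone in the topological sense: every fibre is an interval. *)
Definition monotone_map (g : R -> X) :=
  forall s u t, s <= u <= t -> g s = g t -> g u = g s.

Lemma clamp_cases t : [\/ t <= 0 /\ Num.min 1 (Num.max 0 t) = 0,
  0 <= t <= 1 /\ Num.min 1 (Num.max 0 t) = t |
  1 <= t /\ Num.min 1 (Num.max 0 t) = 1].
Proof.
have [t0|/ltW t0] := leP t 0; first by constructor 1; rewrite min_r.
by have [t1|/ltW t1] := leP t 1; [constructor 2; rewrite t0|constructor 3].
Qed.

Lemma ucont_clamp (g : R -> X) : ucont g ->
  ucont (fun t => g (Num.min 1 (Num.max 0 t))).
Proof.
move=> ug e e0; have [d d0 gd] := ug _ e0; exists d => // s t st; apply: gd.
apply: le_lt_trans st; rewrite ler_norml.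
have := ler_norm (s - t); have := ler_norm (t - s); rewrite distrC.
by case: (clamp_cases s) => -[? ->]; case: (clamp_cases t) => -[? ->]; lra.
Qed.

Lemma clampE t : 0 <= t <= 1 -> Num.min 1 (Num.max 0 t) = t.
Proof. by move=> /andP[t0 t1]; rewrite max_r// min_r. Qed.

Lemma clamp_itv t : 0 <= Num.min 1 (Num.max 0 t) <= 1.
Proof. by rewrite ge_min lexx/= le_min ler01 le_max lexx. Qed.

(** The new path is g composed with the map [l] sending each time to the left end of its gap, or to
    itself outside the gaps. Clamping to [0, 1] makes it constant before 0, so that its whole past
    has a compact image. *)
Lemma monotone_path (g : R -> X) : ucont g -> exists gh : R -> X,
  [/\ ucont gh /\ monotone_map gh, gh 0 = g 0, gh 1 = g 1,
      forall t, t <= 0 -> gh t = gh 0 & forall t, exists s, gh t = g s].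
Proof.
move=> ug; have [G [gG Gmax]] := gapped_maximal ug.
have G01 t : G t -> 0 < t < 1.
  by move=> /gG[a [b [/andP[? ?] [? ?] _ _ _]]]; lra.
have /choice[lr lrP] : forall t, exists ab : R * R,
    (~ G t /\ ab = (t, t)) \/ gap g G t ab.1 ab.2.
  move=> t; have [Gt|Gt] := pselect (G t); last by exists (t, t); left.
  by have [a [b ?]] := gG _ Gt; exists (a, b); right.
pose l t := (lr t).1; pose r t := (lr t).2.
have lrt t : [/\ l t <= t <= r t, ~ G (l t), ~ G (r t) & g (l t) = g (r t)].
  rewrite /l /r; have [[Gt ->]|[/andP[? ?] _ _ [? ?] ?]] := lrP t.
    by rewrite /= lexx.
  by split=> //; lra.
have lE t : ~ G t -> l t = t.
  move=> Gt; rewrite /l; have [[_ ->]//|[h _ hG _ _]] := lrP t.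
  by case: Gt; exact: hG.
have l_const t u : l t <= u <= r t -> g (l u) = g (l t).
  have [_ nGl nGr glr] := lrt t.
  rewrite le_eqVlt => /andP[/orP[/eqP <- _|ltu]]; first by rewrite lE.
  rewrite le_eqVlt => /orP[/eqP ->|utr]; first by rewrite lE.
  congr g; have utr' : l t < u < r t by rewrite ltu.
  rewrite /l /r in ltu utr utr' *.
  case: (lrP t) => [[_ E]|gt]; first by rewrite E /= in ltu utr; lra.
  have gu := gap_shift gt utr'.
  case: (lrP u) => [[Gu _]|gu']; first by case: Gu; have [_ _ + _ _] := gt; apply.
  have [? ?] := gap_sub (@subset_refl _ G) gu gu'.
  have [? ?] := gap_sub (@subset_refl _ G) gu' gu.
  by apply/eqP; rewrite eq_le; apply/andP.
(* Here s' is the right end of the gap of s and t' the left end of the gap of t. Only the passage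
   from s' to t' matters, which is a shorter time interval with ends outside G; continuity and
   monotonicity both reduce to it. *)
have split_st s t : s <= t -> (forall u, s <= u <= t -> g (l u) = g (l s)) \/
    exists s' t', [/\ s <= s' <= t' /\ t' <= t, ~ G s' /\ ~ G t',
       forall u, s <= u <= s' -> g (l u) = g s' &
       forall u, t' <= u <= t -> g (l u) = g t'].
  move=> st; have [/andP[ls sr] nGls nGrs gs] := lrt s.
  have [/andP[lt tr] nGlt nGrt gt] := lrt t.
  have [trs|rst] := leP t (r s).
    left=> u /andP[su ut]; apply: l_const; lra.
  right; exists (r s), (l t); split=> //.
  - split=> //; rewrite sr leNgt /=; apply/negP => tlrs.
    apply: nGrs; move: tlrs tr; rewrite /l /r.
    case: (lrP t) => [[_ ->]/=|[_ _ + _ _]].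
      by move: rst; rewrite /r; lra.
    move=> tG tlrs rtt; apply: tG; rewrite tlrs /=; exact: lt_le_trans rtt.
  - by move=> u /andP[su ur]; rewrite -gs; apply: l_const; lra.
  - by move=> u /andP[su ur]; apply: l_const; lra.
pose gl t := g (l t).
have ugl : ucont gl.
  move=> e e0; have [d d0 gd] := ug _ e0; exists d => //.
  have close s t : s <= t -> `|s - t| < d -> mdist (gl s) (gl t) < e.
    move=> st std; rewrite /gl; have [cst|[s' [t' [[/andP[? ?] ?] _ sE tE]]]] := split_st _ _ st.
      by rewrite (cst t) ?mdistxx// st lexx.
    rewrite sE ?tE; [|lra|lra]; apply: gd; apply: le_lt_trans std.
    by rewrite distrC ger0_norm; [rewrite distrC ger0_norm; lra|lra].
  move=> s t std; have [st|/ltW ts] := leP s t; first exact: close.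
  by rewrite metric_sym; apply: close => //; rewrite distrC.
have mgl s u t : 0 <= s -> t <= 1 -> s <= u <= t -> gl s = gl t -> gl u = gl s.
  move=> s0 t1 /andP[su ut]; rewrite /gl.
  have [cst _|[s' [t' [[/andP[ss' s't'] t't] [Gs' Gt'] sE tE]]]] := split_st _ _ (le_trans su ut).
    by rewrite cst// su.
  rewrite sE ?lexx// (tE t) ?lexx ?andbT// => gE.
  have [us'|s'u] := leP u s'; first by rewrite sE// su.
  have [t'u|ut'] := leP t' u; first by rewrite tE ?gE// t'u.
  (* By maximality of G equal values at s' and t' make ]s', t'[ itself a gap; uniqueness of gaps
     then gives [l u] = s'. *)
  have gapu : gap g G u s' t'.
    split=> //; [by rewrite s'u|by lra|].
    by apply: Gmax => //; lra.
  have Gu : G u by have [_ _ + _ _] := gapu; apply; rewrite s'u.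
  have gap_u : gap g G u (l u) (r u).
    by rewrite /l /r; have [[]|] := lrP u.
  have [? ?] := gap_sub (@subset_refl _ G) gapu gap_u.
  have [? ?] := gap_sub (@subset_refl _ G) gap_u gapu.
  by congr g; apply/eqP; rewrite eq_le; apply/andP.
exists (fun t => gl (Num.min 1 (Num.max 0 t))); split.
- split; first exact: ucont_clamp.
  move=> s u t /andP[su ut]; have /andP[s0 s1] := clamp_itv s.
  have /andP[t0 t1] := clamp_itv t; apply: mgl => //.
  have h a b : a <= b -> Num.min 1 (Num.max 0 a) <= Num.min 1 (Num.max 0 b).
    by case: (clamp_cases a) => -[? ->]; case: (clamp_cases b) => -[? ->]; lra.
  by rewrite !h.
- by rewrite clampE ?lexx ?ler01// /gl lE// => /G01; rewrite ltxx.
- by rewrite clampE ?ler01 ?lexx// /gl lE// => /G01; rewrite ltxx andbF.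
- by move=> t t0; rewrite (max_l t0) maxxx.
- by move=> t; exists (l (Num.min 1 (Num.max 0 t))).
Qed.
End monotone_paths.

(** * Sums of bounded sequences with weights 2^-n *)

Section weighted_sums.
Context {R : realType}.
Implicit Types (a b : nat -> R).

Definition wsum a : R := limn (series (fun n => 2^-1 ^+ n * a n)).

Let geom_cvg (D : R) : series (fun n => D * 2^-1 ^+ n) @ \oo --> D * 2.
Proof.
have := @cvg_geometric_series R D 2^-1.
rewrite (_ : D / (1 - 2^-1) = D * 2); last by field.
by apply; rewrite ger0_norm; lra.
Qed.

Lemma wsum_cvg a D : (forall n, `|a n| <= D) ->
  cvgn (series (fun n => 2^-1 ^+ n * a n)).
Proof.
move=> aD; apply: normed_cvg.
apply: (@series_le_cvg _ _ (fun n => D * 2^-1 ^+ n)) => [n|n|n|].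
- by rewrite /=.
- by rewrite mulr_ge0 ?exprn_ge0// (le_trans _ (aD n)).
- by rewrite /= normrM ger0_norm ?exprn_ge0// mulrC ler_wpM2r// exprn_ge0.
- by apply/cvg_ex; exists (D * 2); exact: geom_cvg.
Qed.

Lemma wsum_ge_term a D k : (forall n, 0 <= a n <= D) ->
  2^-1 ^+ k * a k <= wsum a.
Proof.
move=> aD; have acvg : cvgn (series (fun n => 2^-1 ^+ n * a n)).
  by apply: (@wsum_cvg _ D) => n; rewrite ger0_norm; have /andP[] := aD n.
have a0 n : 0 <= 2^-1 ^+ n * a n.
  by rewrite mulr_ge0 ?exprn_ge0//; have /andP[] := aD n.
have nd : nondecreasing_seq (series (fun n => 2^-1 ^+ n * a n)).
  by apply/nondecreasing_seqP => n; rewrite /series/= big_nat_recr//= lerDl.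
apply: le_trans (nondecreasing_cvgn_le nd acvg k.+1).
rewrite /series/= big_nat_recr//= lerDr.
by apply: sumr_ge0 => i _; exact: a0.
Qed.

Lemma wsum_le a D e : (forall n, `|a n| <= D) -> (forall n, a n <= e) ->
  wsum a <= e * 2.
Proof.
move=> aD ae; have ecvg := @geom_cvg e.
rewrite -(cvg_lim _ ecvg)//; apply: ler_lim.
- exact: wsum_cvg aD.
- by apply/cvg_ex; eexists; exact: ecvg.
apply: nearW => n; apply: ler_sum => i _.
by rewrite mulrC ler_wpM2r ?exprn_ge0.
Qed.

Lemma wsumB a b D : (forall n, `|a n| <= D) -> (forall n, `|b n| <= D) ->
  wsum (fun n => a n - b n) = wsum a - wsum b.
Proof.
move=> aD bD; rewrite /wsum -limB; [|exact: wsum_cvg aD|exact: wsum_cvg bD].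
congr (limn _); apply/funext => n.
rewrite !fctE /series/= -sumrB; apply: eq_bigr => i _; exact: mulrBr.
Qed.

End weighted_sums.

(** * Distance of a point to the part of a path already covered *)

Section distance_to_past.
Context {R : realType} {X : metricType R}.
Implicit Types (A : set X) (p q : X).

Lemma ucont_continuous (g : R -> X) : ucont g -> continuous g.
Proof.
move=> ug t; apply/metricType_numDomainType.cvgrPdist_lt => e e0; have [d d0 gd] := ug _ e0.
by near=> s; apply: gd; near: s; apply: cvgr_dist_lt.
Unshelve. all: by end_near. Qed.

Lemma mdist_continuous (x : X) : continuous (mdist x : X -> R).
Proof.
move=> y; apply/cvgrPdist_lt => e e0; near=> z.
have yz : mdist y z < e.
  near: z; apply: open_nbhs_nbhs; split; first exact: mdist_open.
  by rewrite /= mdistxx.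
have := metric_triangle x y z; have := metric_triangle x z y.
by rewrite (metric_sym z y) ltr_distlC; lra.
Unshelve. all: by end_near. Qed.

Lemma compact_mdist_bounded A : compact A ->
  exists D : R, forall x y, A x -> A y -> mdist x y <= D.
Proof.
move=> cA; have [[x0 Ax0]|A0] := pselect (A !=set0); last first.
  by exists 0 => x y Ax; case: A0; exists x.
have cd : compact ((mdist x0 : X -> R) @` A).
  by apply: continuous_compact => //; exact/continuous_subspaceT/mdist_continuous.
have [M [_ MD]] := compact_bounded cd.
exists ((M + 1) * 2) => x y Ax Ay.
have bd z : A z -> mdist x0 z <= M + 1.
  move=> Az; rewrite (le_trans (ler_norm _))//.
  by apply: (MD (M + 1)); [lra|exists z].
have := metric_triangle x x0 y; rewrite (metric_sym x x0).
by have := bd _ Ax; have := bd _ Ay; lra.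
Qed.

Definition dist_past (g : R -> X) (z : X) (t : R) : R :=
  inf [set mdist (g s) z | s in [set s | s <= t]].

Lemma dist_past_has_inf (g : R -> X) z t :
  has_inf [set mdist (g s) z | s in [set s | s <= t]].
Proof.
split; first by exists (mdist (g t) z); exists t => /=.
by exists 0 => _ [s _ <-]; exact: mdist_ge0.
Qed.

Lemma dist_past_le (g : R -> X) z s t : s <= t -> dist_past g z t <= mdist (g s) z.
Proof. by move=> st; apply: (ge_inf (dist_past_has_inf _ _ _).2); exists s. Qed.

Lemma dist_past_ge (g : R -> X) z t (c : R) :
  (forall s, s <= t -> c <= mdist (g s) z) -> c <= dist_past g z t.
Proof.
move=> cg; apply: lb_le_inf; first exact: (dist_past_has_inf _ _ _).1.
by move=> _ [s st <-]; exact: cg.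
Qed.

Lemma dist_past_ge0 (g : R -> X) z t : 0 <= dist_past g z t.
Proof. by apply: dist_past_ge => s _; exact: mdist_ge0. Qed.

Lemma dist_past_mono (g : R -> X) z s t : s <= t -> dist_past g z t <= dist_past g z s.
Proof.
move=> st; apply: dist_past_ge => u us; apply: dist_past_le; exact: le_trans st.
Qed.

(** By monotonicity g t is not attained up to time s, so it has a distance c > 0 from that past. A
    rational time shortly before t gives a point within c / 2 of g t: covered by time t, but at
    distance at least c / 2 from the past of s. *)
Lemma dist_past_strict (g : R -> X) s t : ucont g -> monotone_map g ->
  (forall u, u <= 0 -> g u = g 0) -> s < t -> g s <> g t ->
  exists q : rat, dist_past g (g (ratr q)) t < dist_past g (g (ratr q)) s.
Proof.
move=> ug mg g0 st gst.
have [c c0 gc] : exists2 c : R, 0 < c & forall u, u <= s -> c <= mdist (g u) (g t).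
  (* As g is constant before 0, the infimum over the whole past of s is a minimum over the compact
     interval from min s 0 to s. *)
  have s0 : Num.min s 0 <= s by rewrite ge_min lexx.
  have [|c cin cmin] := @EVT_min R (fun u => mdist (g t) (g u)) _ _ s0.
    apply: continuous_subspaceT => u; apply: continuous_comp.
      exact: ucont_continuous.
    exact: mdist_continuous.
  have cs : c <= s by move: cin; rewrite in_itv/= => /andP[].
  exists (mdist (g t) (g c)).
    rewrite mdist_gt0; apply/eqP => gtc; apply: gst; rewrite gtc.
    by apply: (mg c s t); rewrite ?cs ?ltW.
  move=> u us; rewrite [leRHS]metric_sym.
  have [u0|u0] := leP (Num.min s 0) u.
    by apply: cmin; rewrite in_itv/= u0.
  have -> : g u = g (Num.min s 0).
    have u00 : u < 0 by move: u0; rewrite lt_min => /andP[].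
    by rewrite g0 ?ltW// [RHS]g0// ge_min lexx orbT.
  by apply: cmin; rewrite in_itv/= lexx.
have [d d0 gd] := ug (c / 2) ltac:(lra).
have lt_st : Num.max s (t - d) < t by rewrite gt_max st/=; lra.
have [q] := rat_in_itvoo lt_st; rewrite in_itv/= gt_max => /andP[/andP[sq tdq] qt].
exists q; apply: (@le_lt_trans _ _ 0).
  by rewrite -(mdistxx (g (ratr q))); apply: dist_past_le; exact: ltW.
apply: (@lt_le_trans _ _ (c / 2)); first by lra.
apply: dist_past_ge => u us; have := gc _ us.
have := metric_triangle (g u) (g (ratr q)) (g t).
have : mdist (g (ratr q)) (g t) < c / 2 by apply: gd; rewrite ltr_distlC; lra.
by lra.
Qed.

End distance_to_past.

(** * Injective reparametrization and the existence of arcs *)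

Section arcs.
Context {R : realType} {X : metricType R}.
Implicit Types (A : set X) (p q : X).

Definition is_arc (g : R -> X) p q :=
  [/\ continuous g, g 0 = p, g 1 = q & set_inj `[0, 1] g].

Lemma monotone_arc (g : R -> X) (D : R) : ucont g -> monotone_map g ->
  (forall u, u <= 0 -> g u = g 0) -> (forall s t, mdist (g s) (g t) <= D) ->
  g 0 <> g 1 ->
  exists2 f : R -> X, is_arc f (g 0) (g 1) & forall u, exists t, f u = g t.
Proof.
move=> ug mg g0 gD g01.
(* As (z n) is dense in the image of g, the weighted sum h of the distances from
   z n to the past of t strictly decreases wherever g moves. *)
pose z n := if @choice.unpickle rat n is Some q then g (ratr q) else g 0.
pose a t n := dist_past g (z n) t.
have zE n : exists t, z n = g t.
  by rewrite /z; case: (choice.unpickle n) => [q|]; eexists.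
have a0 t n : 0 <= a t n <= D.
  rewrite /a; have [s ->] := zE n; rewrite dist_past_ge0/=.
  by rewrite (le_trans (dist_past_le _ _ (lexx t))).
have aD t n : `|a t n| <= D.
  by have /andP[? ?] := a0 t n; rewrite ger0_norm.
pose h t := wsum (a t).
have hB s t : h s - h t = wsum (fun n => a s n - a t n).
  by rewrite (@wsumB _ _ _ D).
have hterm s t n : s <= t -> 2^-1 ^+ n * (a s n - a t n) <= h s - h t.
  move=> st; rewrite hB; apply: (@wsum_ge_term _ _ D) => k.
  have := @dist_past_mono _ _ g (z k) _ _ st.
  by have := a0 s k; have := a0 t k; rewrite /a; lra.
have hmono s t : s <= t -> h t <= h s.
  move=> st; rewrite -subr_ge0; apply: le_trans (hterm _ _ 0%N st).
  by rewrite mul1r subr_ge0; exact: dist_past_mono.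
have hstrict s t : s < t -> g s <> g t -> h t < h s.
  move=> st gst; have [q qst] := dist_past_strict ug mg g0 st gst.
  rewrite -subr_gt0; apply: lt_le_trans (hterm _ _ (choice.pickle q) (ltW st)).
  by rewrite mulr_gt0 ?exprn_gt0// subr_gt0 /a /z choice.pickleK.
have heq s t : s <= t -> g s = g t -> h s = h t.
  move=> st gst; congr wsum; apply/funext => n; apply/eqP.
  rewrite eq_le [X in _ && X]dist_past_mono// andbT.
  apply: dist_past_ge => u ut; have [us|su] := leP u s; first exact: dist_past_le.
  by rewrite (mg s u t)// ?ut ?(ltW su)//; exact: dist_past_le.
have hcont : continuous h.
  move=> t; apply/cvgrPdist_lt => e e0; have [d d0 gd] := ug (e / 3) ltac:(lra).
  have close s u : s <= u -> `|s - u| < d -> h s - h u <= e / 3 * 2.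
    move=> su sud; rewrite hB; apply: (@wsum_le _ _ (D + D)) => n.
      by rewrite (le_trans (ler_normB _ _))// lerD.
    suff : a s n - e / 3 <= a u n by lra.
    apply: dist_past_ge => v vu; have [vs|sv] := leP v s.
      by have := @dist_past_le _ _ g (z n) _ _ vs; rewrite /a; lra.
    have := @dist_past_le _ _ g (z n) _ _ (lexx s).
    have := metric_triangle (g s) (g v) (z n).
    have : mdist (g s) (g v) < e / 3.
      apply: gd; apply: le_lt_trans sud.
      by rewrite ltr0_norm ?ler0_norm; lra.
    by rewrite /a; lra.
  near=> s; have std : `|t - s| < d by near: s; exact: cvgr_dist_lt.
  have [st|/ltW st] := leP s t.
    rewrite ler0_norm ?subr_le0 ?hmono//.
    by have := close _ _ st; rewrite distrC std => /(_ isT); lra.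
  rewrite ger0_norm ?subr_ge0 ?hmono//.
  by have := close _ _ st std; lra.
have h10 : h 1 < h 0 by exact: hstrict.
have hinj s t : h s = h t -> g s = g t.
  wlog st : s t / s <= t.
    by move=> wl hst; have [/wl|/ltW/wl H] := leP s t; [exact|apply/esym/H].
  move=> hst; apply: contrapT => gst.
  move: st; rewrite le_eqVlt => /orP[/eqP E|st]; first by rewrite E in gst.
  by have := hstrict _ _ st gst; rewrite hst ltxx.
have hfun s t : g s = g t -> h s = h t.
  wlog st : s t / s <= t.
    by move=> wl gst; have [/wl|/ltW/wl H] := leP s t; [exact|apply/esym/H].
  exact: heq.
(* The parameter u runs linearly through the values of h from h 0 down to h 1, and [tau] picks any
   time with that value. The choice is immaterial because g and h have the same fibres. *)
pose v u := h 0 + u * (h 1 - h 0).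
have /choice[tau tauP] : forall u, exists t, 0 <= u <= 1 -> 0 <= t <= 1 /\ h t = v u.
  move=> u; have [u01|nu] := pselect (is_true (0 <= u <= 1)); last by exists 0.
  have [||c cin hc] := @IVT R h 0 1 (v u) ler01.
  - exact: continuous_subspaceT.
  - have -> : Num.min (h 0) (h 1) = h 1 by rewrite min_r// ltW.
    have -> : Num.max (h 0) (h 1) = h 0 by rewrite max_l// ltW.
    rewrite /v; nra.
  by exists c; move: cin; rewrite in_itv/=.
pose f u := g (tau (Num.min 1 (Num.max 0 u))).
have fE u : 0 <= u <= 1 -> f u = g (tau u) by move=> u01; rewrite /f clampE.
have c0 : 0 <= (0 : R) <= 1 by rewrite lexx ler01.
have c1 : 0 <= (1 : R) <= 1 by rewrite lexx ler01.
exists f; last by move=> u; eexists.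
split.
(* The times whose g-value is at least e away from g (tau u) form a compact set C. Its image under h
   is closed and misses v u, hence misses a neighbourhood of v u. *)
- have fcont u : 0 <= u <= 1 -> forall e, 0 < e -> exists2 d, 0 < d &
      forall w, 0 <= w <= 1 -> `|u - w| < d -> mdist (f u) (f w) < e.
    move=> u01 e e0; have [tu01 htu] := tauP _ u01.
    pose C := `[0, 1]%classic `&` [set t | e <= mdist (g (tau u)) (g t)].
    have cC : compact C.
      apply: compact_closedI; first exact: segment_compact.
      apply: (@closed_comp _ _ (mdist (g (tau u)) \o g) [set r | e <= r]).
        move=> t _; apply: continuous_comp; first exact: ucont_continuous.
        exact: mdist_continuous.
      exact: closed_ge.
    have chC : closed (h @` C).
      apply: compact_closed; first exact: Rhausdorff.
      by apply: continuous_compact => //; exact: continuous_subspaceT.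
    have nvC : (~` (h @` C)) (v u).
      by move=> [t [_ /= tC] /esym]; rewrite -htu => /hinj E; move: tC; rewrite E mdistxx leNgt e0.
    have /nbhs_ballP[d /= d0 dC] : nbhs (v u) (~` (h @` C)).
      by apply: open_nbhs_nbhs; split=> //; exact: closed_openC.
    exists (d / (h 0 - h 1)); first by rewrite divr_gt0// subr_gt0.
    move=> w w01 uw; have [tw01 htw] := tauP _ w01.
    rewrite !fE// ltNge; apply/negP => etw.
    have : (~` (h @` C)) (v w).
      apply: dC; rewrite /ball/= /v.
      have -> : h 0 + u * (h 1 - h 0) - (h 0 + w * (h 1 - h 0)) = (u - w) * (h 1 - h 0) by ring.
      rewrite normrM [X in _ * X]distrC [X in _ * X]gtr0_norm ?subr_gt0//.
      by rewrite -ltr_pdivlMr// subr_gt0.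
    by apply; exists (tau w) => //; split=> //; rewrite /= in_itv.
  move=> t; apply/metricType_numDomainType.cvgrPdist_lt => e e0.
  have [d d0 fd] := fcont _ (clamp_itv t) _ e0.
  near=> s; have std : `|t - s| < d by near: s; exact: cvgr_dist_lt.
  have fcl r : f (Num.min 1 (Num.max 0 r)) = f r.
    by rewrite /f [in LHS]clampE// clamp_itv.
  rewrite -(fcl t) -(fcl s); apply: fd; first exact: clamp_itv.
  apply: le_lt_trans std; rewrite ler_norml.
  have := ler_norm (s - t); have := ler_norm (t - s); rewrite distrC.
  by case: (clamp_cases s) => -[? ->]; case: (clamp_cases t) => -[? ->]; lra.
- rewrite fE//; apply: hinj; have [_ ->] := tauP _ c0.
  by rewrite /v mul0r addr0.
- rewrite fE//; apply: hinj; have [_ ->] := tauP _ c1.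
  by rewrite /v mul1r addrC subrK.
- move=> u w; rewrite !inE/= !in_itv/= => u01 w01; rewrite !fE// => /hfun.
  have [_ ->] := tauP _ u01; have [_ ->] := tauP _ w01.
  move=> /addrI/mulIf; apply; apply/eqP; lra.
Unshelve. all: by end_near. Qed.

Definition peano A := continuum A /\ locally_connected A.

Lemma peano_arc A p q : peano A -> A p -> A q -> p <> q ->
  exists2 g : R -> X, is_arc g p q & g @` `[0, 1] `<=` A.
Proof.
move=> [[_ cA connA] lcA] Ap Aq pq.
have [f [uf f0 f1 fA]] := peano_path cA connA lcA Ap Aq.
have [g [[ug mg] g0 g1 gneg gf]] := monotone_path uf.
have gA t : A (g t) by have [s ->] := gf t.
have [D AD] := compact_mdist_bounded cA.
have [||k] := @monotone_arc g D ug mg gneg.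
- by move=> s t; exact: AD.
- by rewrite g0 f0 g1 f1.
rewrite g0 f0 g1 f1 => arck kg; exists k => // _ [t _ <-].
by have [s ->] := kg t.
Qed.

End arcs.

(** * Peano continua and dendrites *)

Section peano_sets.
Context {R : realType} {X : metricType R}.
Implicit Types (A B C K : set X) (p q x : X).

Lemma peano_closed A : peano A -> closed A.
Proof. by move=> [[_ cA _] _]; apply: compact_closed => //; exact: metric_hausdorff. Qed.

Lemma peano1 x : peano [set x].
Proof.
split; first by split; [exists x|exact: compact_set1|exact: connected1].
move=> _ U -> oU Ux; exists U; split=> //.
have -> : [set x] `&` U = [set x] by apply/seteqP; split=> [y []|_ ->].
exact: connected1.
Qed.

(* Connectedness im kleinen at every point suffices: the components of relatively
   open sets are then relatively open. *)
Lemma weakly_locally_connected A :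
  (forall x U, A x -> open U -> U x -> exists V N,
    [/\ open V /\ V x, connected N, N x, N `<=` A `&` U & A `&` V `<=` N]) ->
  locally_connected A.
Proof.
move=> wA x U Ax oU Ux; pose Q := connected_component (A `&` U) x.
pose V := \bigcup_(W in [set W | open W /\ A `&` W `<=` Q]) W.
have AVQ : A `&` V = Q.
  apply/seteqP; split=> [y [Ay [W [_ WQ] Wy]]|y Qy]; first exact: WQ.
  have [Ay Uy] := connected_component_sub Qy.
  have [W [N [[oW Wy] cN Ny NU WN]]] := wA _ _ Ay oU Uy.
  split=> //; exists W => //; split=> // z /WN Nz.
  apply: connected_component_trans Qy _.
  exact: (connected_component_max Ny NU cN).
exists V; split.
- by apply: bigcup_open => W [].
- suff : (A `&` V) x by case.
  by rewrite AVQ; exact: connected_component_refl.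
- by rewrite AVQ; exact: component_connected.
- by rewrite AVQ => y /connected_component_sub[].
Qed.

(** At a point of only one of the sets, the other one is closed and can be avoided; at a common
    point the two connected neighbourhoods join at that point. *)
Lemma peanoU A B : peano A -> peano B -> A `&` B !=set0 -> peano (A `|` B).
Proof.
move=> pA pB AB; have [[A0 cA connA] lA] := pA; have [[B0 cB connB] lB] := pB.
split; first split.
- by have [x Ax] := A0; exists x; left.
- exact: compactU.
- exact: connectedU.
have half A' U x : peano A' -> open U -> U x -> exists V N,
    [/\ open V /\ V x, A' x -> N x /\ connected N, ~ A' x -> N = set0,
     N `<=` A' `&` U & A' `&` V `<=` N].
  move=> pA' oU Ux; have [A'x|A'x] := pselect (A' x).
    have [V [oV Vx cV VU]] := pA'.2 _ _ A'x oU Ux.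
    by exists V, (A' `&` V); split=> // y A'Vy; split; [case: A'Vy|exact: VU].
  exists (~` A'), set0; split=> //; last by rewrite setICr.
  by split=> //; apply: closed_openC; exact: peano_closed.
apply: weakly_locally_connected => x U ABx oU Ux.
have [V [N [[oV Vx] NA NnA NU VN]]] := half A U x pA oU Ux.
have [W [M [[oW Wx] MB MnB MU WM]]] := half B U x pB oU Ux.
exists (V `&` W), (N `|` M); split.
- by split=> //; exact: openI.
- have [Ax|Ax] := pselect (A x); have [Bx|Bx] := pselect (B x).
  + have [Nx cN] := NA Ax; have [Mx cM] := MB Bx.
    by apply: connectedU => //; exists x.
  + by rewrite (MnB Bx) setU0; have [] := NA Ax.
  + by rewrite (NnA Ax) set0U; have [] := MB Bx.
  + by case: ABx.
- by case: ABx => [/NA[]|/MB[]]; [left|right].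
- by move=> y [/NU[? ?]|/MU[? ?]]; split=> //; [left|right].
- by move=> y [[Ay|By] [Vy Wy]]; [left; exact: VN|right; exact: WM].
Qed.

(** On the compact A the map f is an embedding: the complement of f (A \ V) is open and meets the
    image exactly in f (A [&] V). T is general because this serves both self-maps of X and arcs
    parametrized by R. *)
Lemma locally_connected_image (T : topologicalType) (A : set T) (f : T -> X) :
  continuous f -> set_inj A f -> compact A ->
  (forall (x : T) (U : set T), A x -> open U -> U x ->
     exists V, [/\ open V, V x, connected (A `&` V) & A `&` V `<=` U]) ->
  locally_connected (f @` A).
Proof.
move=> cf injf cA lA _ U [x Ax <-] oU Ux.
have [V [oV Vx cV VU]] := lA x (f @^-1` U) Ax (open_comp (fun y _ => cf y) oU) Ux.
have cfAV : closed (f @` (A `\` V)).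
  apply: compact_closed; first exact: metric_hausdorff.
  apply: continuous_compact; first exact: continuous_subspaceT.
  by apply: compact_closedI => //; exact: open_closedC.
have E : f @` A `&` ~` (f @` (A `\` V)) = f @` (A `&` V).
  apply/seteqP; split=> [_ [[y Ay <-] nfy]|_ [y [Ay Vy] <-]].
    exists y => //; split=> //; apply: contrapT => nVy; apply: nfy.
    by exists y.
  split; first by exists y.
  move=> [z [Az nVz]] fzy; apply: nVz.
  by rewrite (injf z y) ?inE.
exists (~` (f @` (A `\` V))); split.
- exact: closed_openC.
- have : (f @` (A `&` V)) (f x) by exists x.
  by rewrite -E => -[].
- rewrite E; apply: connected_continuous_connected => //.
  exact: continuous_subspaceT.
- by rewrite E => _ [y /VU ? <-].
Qed.

Lemma peano_image (f : X -> X) A : continuous f -> injective f -> peano A ->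
  peano (f @` A).
Proof.
move=> cf injf [[[x Ax] cA connA] lA]; split; first split.
- by exists (f x); exists x.
- by apply: continuous_compact => //; exact: continuous_subspaceT.
- by apply: connected_continuous_connected => //; exact: continuous_subspaceT.
- by apply: locally_connected_image => // ? ? _ _; exact: injf.
Qed.

Lemma itv01_connected : connected (`[0, 1] : set R).
Proof. by apply/connected_intervalP; exact: interval_is_interval. Qed.

Lemma peano_arc_image (g : R -> X) p q : is_arc g p q -> peano (g @` `[0, 1]).
Proof.
move=> [cg g0 g1 injg]; split; first split.
- by exists (g 0); exists 0 => //; rewrite /= in_itv/= lexx ler01.
- apply: continuous_compact; first exact: continuous_subspaceT.
  exact: segment_compact.
- apply: connected_continuous_connected; first exact: itv01_connected.
  exact: continuous_subspaceT.
apply: locally_connected_image => //; first exact: segment_compact.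
move=> x U x01 oU Ux.
have /nbhs_ballP[e /= e0 eU] : nbhs x U by exact: open_nbhs_nbhs.
exists (ball x e); split.
- exact: ball_open.
- exact: ballxx.
- apply/connected_intervalP => s t /=; rewrite !in_itv/= /ball/=.
  move=> [s01 xs] [t01 xt] u /andP[su ut]; rewrite in_itv/=.
  by move: xs xt; rewrite !ltr_distlC; lra.
- by move=> y [_ /eU].
Qed.

Lemma finite_arc (g : R -> X) p q C : is_arc g p q -> finite_set C ->
  ~ (g @` `[0, 1] `<=` C).
Proof.
move=> [_ _ _ injg] fC gC.
have n01 (n : nat) : 0 <= (n.+1%:R^-1 : R) <= 1.
  by rewrite invr_ge0 ler0n/= invf_le1 ?ltr0n// ler1n.
have : finite_set ((fun n : nat => g n.+1%:R^-1) @^-1` C).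
  apply: finite_preimage => // m n _ _ /injg; rewrite !inE/= !in_itv/=.
  by move=> /(_ (n01 _) (n01 _))/invr_inj/eqP; rewrite eqr_nat => /eqP[].
rewrite (_ : _ @^-1` C = setT); first exact: infinite_nat.
apply/seteqP; split=> // n _; apply: gC; exists n.+1%:R^-1 => //.
by rewrite /= in_itv/=.
Qed.

Lemma last_visit (g : R -> X) C t : continuous g -> closed C ->
  0 <= t <= 1 -> C (g 0) -> exists s, [/\ 0 <= s <= t, C (g s) &
    forall u, s < u <= t -> ~ C (g u)].
Proof.
move=> cg clC /andP[t0 t1] C0.
pose Z := [set s | 0 <= s <= t] `&` (g @^-1` C).
have Z0 : Z !=set0 by exists 0; split=> //=; rewrite lexx.
have ubZ : has_ubound Z by exists t => s [/= /andP[]].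
have clZ : closed Z.
  apply: closedI; last exact: closed_comp.
  rewrite (_ : [set s | _] = `[0, t]%classic); first exact: itv_closed.
  by apply/seteqP; split=> s; rewrite /= in_itv.
have [s0t Cs] : Z (sup Z) by apply: clZ; exact: closure_sup.
exists (sup Z); split=> // u /andP[su ut] Cu.
have : u <= sup Z.
  by apply: ub_le_sup => //; split=> //=; rewrite ut andbT (le_trans _ (ltW su))//; case/andP: s0t.
by rewrite leNgt su.
Qed.

(** If g t is off the arc H of h, let ]s1, s2[ be the largest interval of times around t during
    which g avoids H. The piece of g over [s1, s2], closed up by the piece of h between its two
    ends, is a simple closed curve in K. *)
Lemma arc_unique (g h : R -> X) p q K :
  ~ (exists2 C, simple_closed_curve C & C `<=` K) ->
  is_arc g p q -> is_arc h p q -> g @` `[0, 1] `<=` K -> h @` `[0, 1] `<=` K ->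
  g @` `[0, 1] `<=` h @` `[0, 1].
Proof.
move=> noscc [cg g0 g1 injg] arch gK hK.
have [ch h0 h1 injh] := arch.
have clH := peano_closed (peano_arc_image arch).
set H := h @` `[0, 1] in clH *.
move=> _ [t t01 <-]; apply: contrapT => ngt; apply: noscc.
rewrite /= in_itv/= in t01.
have Hp : H p by rewrite -h0; exists 0 => //; rewrite /= in_itv/= lexx ler01.
have Hq : H q by rewrite -h1; exists 1 => //; rewrite /= in_itv/= lexx ler01.
have [s1 [s1t Hs1 s1P]] : exists s, [/\ 0 <= s <= t, H (g s) &
    forall u, s < u <= t -> ~ H (g u)].
  by apply: last_visit => //; rewrite g0.
have [s2 [s2t Hs2 s2P]] : exists s, [/\ t <= s <= 1, H (g s) &
    forall u, t <= u < s -> ~ H (g u)].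
  (* The first return to H after t is a last visit of the reversed path. *)
  have [||||s [st Hs sP]] := @last_visit (fun u => g (1 - u)) H (1 - t).
  - move=> u; apply: continuous_comp; last exact: cg.
    by apply: cvgB; [exact: cvg_cst|exact: cvg_id].
  - by [].
  - lra.
  - by rewrite subr0 g1.
  exists (1 - s); split=> //; first by lra.
  move=> u utu; have := sP (1 - u); rewrite subKr; apply; lra.
have tn1 : t <> s1 by move=> E; rewrite E in ngt.
have tn2 : t <> s2 by move=> E; rewrite E in ngt.
have s1lt : s1 < t by rewrite lt_neqAle; apply/andP; split; [apply/eqP/nesym|lra].
have s2lt : t < s2 by rewrite lt_neqAle; apply/andP; split; [apply/eqP|lra].
have s12P u : s1 <= u <= s2 -> H (g u) -> u = s1 \/ u = s2.
  move=> /andP[]; rewrite le_eqVlt => /orP[/eqP <-|s1u]; first by left.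
  rewrite le_eqVlt => /orP[/eqP <-|us2]; first by right.
  by have [ut|/ltW tu] := leP u t => Hu;
    [case: (s1P u)|case: (s2P u)]; rewrite ?s1u ?tu.
have [u1 u101 hu1] := Hs1; have [u2 u201 hu2] := Hs2.
rewrite /= !in_itv/= in u101 u201.
have u12 : u1 <> u2.
  move=> E; have : g s1 = g s2 by rewrite -hu1 -hu2 E.
  by move=> /injg; rewrite !inE/= !in_itv/=; lra.
(* During [0, 1/2] the curve follows g from s1 to s2, during [1/2, 1] it follows h from u2 back to
   u1, whichever of u1 and u2 is larger. *)
pose c1 (t : R) := s1 + 2 * t * (s2 - s1).
pose c2 (t : R) := u2 + (2 * t - 1) * (u1 - u2).
pose c (t : R) := if t <= 2^-1 then g (c1 t) else h (c2 t).
have c1_01 s : 0 <= s <= 2^-1 -> s1 <= c1 s <= s2 by rewrite /c1; nra.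
have c2_01 s : 2^-1 <= s <= 1 -> 0 <= c2 s <= 1.
  by rewrite /c2; have [|] := leP u1 u2; nra.
have cont_aff (a b : R) (f : R -> X) (k : R -> R) : continuous f ->
    (forall t, k t = a + b * t) -> continuous (f \o k).
  move=> cf kE s; apply: continuous_comp; last exact: cf.
  rewrite (_ : k = fun t => a + b * t); last exact/funext.
  apply: cvgD; first exact: cvg_cst.
  by apply: cvgM; [exact: cvg_cst|exact: cvg_id].
have cc1 : continuous (g \o c1).
  apply: (cont_aff s1 (2 * (s2 - s1))) => // s; rewrite /c1; ring.
have cc2 : continuous (h \o c2).
  apply: (cont_aff (u2 - (u1 - u2)) (2 * (u1 - u2))) => // s; rewrite /c2; ring.
have chalf : g (c1 2^-1) = h (c2 2^-1).
  rewrite /c1 /c2 divff ?mul1r ?subrr ?mul0r ?addr0// addrC subrK hu2//.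
exists (c @` `[0, 1]); last first.
  move=> _ [s /= + <-]; rewrite in_itv/= => s01; rewrite /c; case: ifPn => sh.
    by apply: gK; exists (c1 s) => //; rewrite /= in_itv/=; have := c1_01 s; lra.
  by apply: hK; exists (c2 s) => //; rewrite /= in_itv/=; have := c2_01 s; lra.
exists c; split=> //.
- rewrite (_ : `[0, 1]%classic = `[0, 2^-1] `|` `[2^-1, 1] :> set R); last first.
    by apply/seteqP; split=> s /=; rewrite !in_itv/=;
      [have [] := leP s 2^-1; [left|right]; lra | move=> []; lra].
  apply: withinU_continuous; [exact: itv_closed|exact: itv_closed| |].
    apply: (@subspace_eq_continuous _ _ _ (g \o c1)).
      by move=> s; rewrite inE/= in_itv/= => /andP[_ sh]; rewrite /from_subspace /c /= sh.
    exact: continuous_subspaceT.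
  apply: (@subspace_eq_continuous _ _ _ (h \o c2)).
    move=> s; rewrite inE/= in_itv/= => /andP[sh _]; rewrite /from_subspace /c /=.
    case: ifPn => // sh'; have -> : s = 2^-1 by apply/eqP; rewrite eq_le sh sh'.
    by rewrite /= chalf.
  exact: continuous_subspaceT.
- rewrite /c ifT ?invr_ge0// ifF; last by apply/negbTE; rewrite -ltNge; lra.
  rewrite /c1 /c2 mulr0 mul0r addr0 -hu1; congr h; ring.
(* The first half meets H only at its two ends, which are h u1 and h u2; by injectivity of h the
   second half takes these values only at r = 1 and r = 1/2. *)
- have cross s r : 0 <= s <= 2^-1 -> 2^-1 < r < 1 -> g (c1 s) <> h (c2 r).
    move=> s01 r01 E.
    have Hc : H (g (c1 s)).
      by rewrite E; exists (c2 r) => //; rewrite /= in_itv/=; apply: c2_01; lra.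
    have hE v : 0 <= v <= 1 -> h v = h (c2 r) -> v = c2 r.
      move=> v01 /injh; rewrite !inE/= !in_itv/=; apply=> //; apply: c2_01; lra.
    have [Es|Es] := s12P _ (c1_01 _ s01) Hc.
      have : u1 = c2 r by apply: hE => //; rewrite -E Es.
      rewrite /c2 => /eqP; rewrite -subr_eq0.
      rewrite (_ : _ - _ = (u1 - u2) * (2 - 2 * r)); last by ring.
      by rewrite mulf_eq0 => /orP[/eqP|/eqP]; [move=> ?; apply: u12; lra|lra].
    have : u2 = c2 r by apply: hE => //; rewrite -E Es.
    rewrite /c2 => /eqP; rewrite -subr_eq0.
    rewrite (_ : _ - _ = (u1 - u2) * (1 - 2 * r)); last by ring.
    by rewrite mulf_eq0 => /orP[/eqP|/eqP]; [move=> ?; apply: u12; lra|lra].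
  move=> s r; rewrite !inE/= !in_itv/= /c => s01 r01.
  case: ifPn => sh; case: ifPn => rh.
  + have cs := c1_01 s; have cr := c1_01 r.
    move=> /injg; rewrite !inE/= !in_itv/= => /(_ _ _)/addrI.
    have E := mulIf; move=> H1.
    have /mulIf : (s2 - s1) != 0 by apply/eqP; lra.
    move=> inj1; have := H1 ltac:(lra) ltac:(lra) => /inj1; lra.
  + by move=> /cross []; lra.
  + by move=> /esym/cross []; lra.
  + have cs := c2_01 s; have cr := c2_01 r.
    move=> /injh; rewrite !inE/= !in_itv/= => /(_ _ _)/addrI H1.
    have /mulIf inj1 : (u1 - u2) != 0 by apply/eqP => ?; apply: u12; lra.
    have := H1 ltac:(lra) ltac:(lra) => /inj1; lra.
Qed.

(** A Peano subcontinuum through p and q contains an arc between them, which is the given one by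
    uniqueness. Thus the arc is the least Peano subcontinuum containing p and q. *)
Lemma dendrite_arc K p q : dendrite K -> K p -> K q -> p <> q ->
  exists2 g : R -> X, is_arc g p q &
   forall A, peano A -> A `<=` K -> A p -> A q -> g @` `[0, 1] `<=` A.
Proof.
move=> [cK lK nscc] Kp Kq pq.
have [g arcg gK] := peano_arc (conj cK lK) Kp Kq pq.
exists g => // A pA AK Ap Aq; have [h arch hA] := peano_arc pA Ap Aq pq.
apply: subset_trans (hA); apply: (arc_unique nscc arcg arch) => //.
exact: subset_trans hA AK.
Qed.

End peano_sets.

(** * Sets with at least two or three elements *)

Section small_cardinals.
Context {T : Type}.
Implicit Types (A : set T) (a b c : T).

Lemma card_ge_mem n A : A #>= `I_n ->
  exists f : forall i, (i < n)%N -> T,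
    (forall i h, A (f i h)) /\ forall i j h h', f i h = f j h' -> i = j.
Proof.
move=> /card_leP[f].
exists (fun i h => val (f (SigSub (mem_set h : i \in `I_n)))); split.
  by move=> i h; exact: set_mem (valP _).
move=> i j h h' /val_inj/(@inj _ _ _ f); rewrite !in_setT => /(_ isT isT).
by move=> /(congr1 val).
Qed.

Lemma card_ge_inj n A (f : nat -> T) : (forall i, (i < n)%N -> A (f i)) ->
  set_inj `I_n f -> A #>= `I_n.
Proof.
move=> Af injf; apply: (@card_le_trans _ _ _ (f @` `I_n)).
  by have := inj_card_eq injf; rewrite card_eq_le => /andP[].
by apply: subset_card_le => _ [i /Af ? <-].
Qed.

Lemma card_ge3P A : A #>= `I_3 <->
  exists a b c, [/\ A a, A b & A c] /\ [/\ a <> b, a <> c & b <> c].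
Proof.
split=> [/card_ge_mem[f [Af finj]]|[a [b [c [[Aa Ab Ac] [ab ac bc]]]]]].
  exists (f 0%N isT), (f 1%N isT), (f 2%N isT); split=> //.
  by split=> /finj.
apply: (@card_ge_inj _ _ (fun i => if i is i'.+1 then if i' is _.+1 then c else b else a)).
  by move=> [|[|[|]]].
by move=> [|[|[|i]]] [|[|[|j]]] /set_mem hi /set_mem hj E //;
  solve [by case: ab|by case: ac|by case: bc].
Qed.

Lemma card_ge2P A : A #>= `I_2 <-> exists a b, [/\ A a, A b & a <> b].
Proof.
split=> [/card_ge_mem[f [Af finj]]|[a [b [Aa Ab ab]]]].
  exists (f 0%N isT), (f 1%N isT); split=> //.
  by move=> /finj.
apply: (@card_ge_inj _ _ (fun i => if i is _.+1 then b else a)).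
  by move=> [|[|]].
by move=> [|[|i]] [|[|j]] /set_mem hi /set_mem hj E //; case: ab.
Qed.

End small_cardinals.

(** * Ramification points of the main tree separate three boundary points *)

Section main_tree_separation.
Context {R : realType} {X : metricType R}.
Implicit Types (A C D K P : set X) (p q x y : X).

(* x lies on the arc from p to q of the dendrite K.  Peano continua, unlike arcs,
   are stable under unions of overlapping sets. *)
Definition sep K x p q := forall A, peano A -> A `<=` K -> A p -> A q -> A x.

(** The arc as a set, with the degenerate case p = q included so that the arcs from a fixed base
    point to all of P can be treated alike. The last clause cuts the arc at y and keeps the half
    without x. *)
Lemma dendrite_segment K p q : dendrite K -> K p -> K q -> exists L : set X,
  [/\ peano L, L `<=` K, L p /\ L q,
   forall A, peano A -> A `<=` K -> A p -> A q -> L `<=` A &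
   forall x y, x <> p -> x <> q -> L y -> y <> x -> exists C,
     [/\ connected C, C `<=` L, C y, ~ C x & C p \/ C q]].
Proof.
move=> dK Kp Kq; have [<-|pq] := pselect (p = q).
  exists [set p]; split=> //; first exact: peano1.
  - by move=> _ ->.
  - by move=> A _ _ Ap _ _ ->.
  - move=> x y xp _ -> px; exists [set p]; split=> //; last by left.
    exact: connected1.
have [g arcg gmin] := dendrite_arc dK Kp Kq pq.
have [cg g0 g1 injg] := arcg.
have Lp : (g @` `[0, 1]) p by exists 0 => //; rewrite /= in_itv/= lexx ler01.
have Lq : (g @` `[0, 1]) q by exists 1 => //; rewrite /= in_itv/= lexx ler01.
have [cK lK _] := dK.
exists (g @` `[0, 1]); split=> //.
- exact: peano_arc_image arcg.
- by apply: gmin => //.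
move=> x y xp xq [t + gty] yx; rewrite /= in_itv/= => t01.
have itv_conn a b : 0 <= a -> b <= 1 ->
    connected (g @` `[a, b]) /\ g @` `[a, b] `<=` g @` `[0, 1].
  move=> a0 b1; split.
    apply: connected_continuous_connected; last exact: continuous_subspaceT.
    by apply/connected_intervalP; exact: interval_is_interval.
  by move=> _ [s /= sab <-]; exists s => //; move: sab; rewrite /= !in_itv/=; lra.
have [[s + gsx]|nx] := pselect ((g @` `[0, 1]) x); last first.
  exists (g @` `[0, 1]); split=> //; [|by exists t; rewrite //= in_itv|by left].
  by have [] := itv_conn 0 1 (lexx _) (lexx _).
rewrite /= in_itv/= => s01.
have gE r : 0 <= r <= 1 -> g r = x -> r = s.
  by rewrite -gsx => r01 /injg; rewrite !inE/= !in_itv/=; exact.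
have st : s <> t by move=> E; apply: yx; rewrite -gty -gsx E.
have [ts|st'] := leP t s.
  have [cc cs] := itv_conn 0 t (lexx _) ltac:(lra).
  exists (g @` `[0, t]); split=> //.
  - by exists t; rewrite //= in_itv/=; lra.
  - move=> [r /= + grx]; rewrite in_itv/= => r0t.
    by have := gE r ltac:(lra) grx => rs; apply: st; lra.
  - by left; exists 0; rewrite //= in_itv/=; lra.
have [cc cs] := itv_conn t 1 ltac:(lra) (lexx _).
exists (g @` `[t, 1]); split=> //.
- by exists t; rewrite //= in_itv/=; lra.
- move=> [r /= + grx]; rewrite in_itv/= => r0t.
  by have := gE r ltac:(lra) grx => rs; apply: st; lra.
- by right; exists 1; rewrite //= in_itv/=; lra.
Qed.

Lemma peano_bigcup_seq (I : choiceType) (s : seq I) (F : I -> set X) p :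
  (forall i, i \in s -> peano (F i) /\ F i p) ->
  peano ([set p] `|` \bigcup_(i in [set` s]) F i).
Proof.
elim: s => [_|a s IHs sF].
  by rewrite set_nil bigcup_set0 setU0; exact: peano1.
have -> : [set` a :: s] = a |` [set` s].
  apply/seteqP; split=> i /=; rewrite inE; first by move=> /orP[/eqP|]; [left|right].
  by move=> [->|->]; rewrite ?eqxx ?orbT.
rewrite bigcup_setU1 setUCA; apply: peanoU.
- by have [] := sF a (mem_head _ _).
- by apply: IHs => i si; apply: sF; rewrite inE si orbT.
- exists p; split; last by left.
  by have [] := sF a (mem_head _ _).
Qed.

(** The arcs from one point p0 of P to the others form a subdendrite containing P, hence cover H.
    Cutting such an arc links any point of H other than x to a point of P without passing x. Since
    arcs between points of P lie in H, points of P in different components are separated by x. *)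
Lemma main_tree_sep K P x : dendrite K -> P `<=` K -> finite_set P -> ~ P x ->
  ramification_point (main_tree_of K P) x ->
  exists p1 p2 p3, [/\ P p1, P p2 & P p3] /\ [/\ p1 <> p2, p1 <> p3 & p2 <> p3] /\
    [/\ sep K x p1 p2, sep K x p1 p3 & sep K x p2 p3].
Proof.
move=> dK PK finP nPx [gx br]; set H := main_tree_of K P in gx br.
have [cK lK noscc] := dK.
have dsub A : peano A -> A `<=` K -> dendrite A.
  move=> [cA lA] AK; split=> // -[C sC CA]; apply: noscc; exists C => //.
  exact: subset_trans CA AK.
have HD D : dendrite D -> D `<=` K -> P `<=` D -> H `<=` D.
  by move=> dD DK PD y; apply.
have Lch pq : exists L : set X, P pq.1 -> P pq.2 -> [/\ peano L, L `<=` K, L pq.1 /\ L pq.2,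
   forall A, peano A -> A `<=` K -> A pq.1 -> A pq.2 -> L `<=` A &
   forall x y, x <> pq.1 -> x <> pq.2 -> L y -> y <> x -> exists C,
     [/\ connected C, C `<=` L, C y, ~ C x & C pq.1 \/ C pq.2]].
  have [Pp|nPp] := pselect (P pq.1); last by exists setT.
  have [Pq|nPq] := pselect (P pq.2); last by exists setT.
  by have [L ?] := dendrite_segment dK (PK _ Pp) (PK _ Pq); exists L.
have [L LP] := choice Lch.
have LH p q : P p -> P q -> L (p, q) `<=` H.
  move=> Pp Pq y Ly D [[[cD lD _] DK] PD].
  by have [_ _ _ + _] := LP (p, q) Pp Pq; apply => //; exact: PD.
have [c1 [c2 [c3 [[br1 br2 br3] [c12 c13 c23]]]]] := (card_ge3P _).1 br.
(* For empty P the singleton of x would be an admissible subdendrite, leaving no branch at x. *)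
have [p0 Pp0] : P !=set0.
  apply: contrapT => /nonemptyPn P0.
  have [y [Hy yx] _] := br1.
  have : H y -> y = x; last by move=> /(_ Hy).
  apply: (HD [set x]).
  - apply: dsub; first exact: peano1.
    by move=> _ ->; apply: (HD K).
  - by move=> _ ->; apply: (HD K).
  - by rewrite P0.
have HL : H `<=` \bigcup_(q in P) L (p0, q).
  have [s sP] := (finite_seqP P).1 finP.
  have E : \bigcup_(q in P) L (p0, q) = [set p0] `|` \bigcup_(q in P) L (p0, q).
    apply/esym/setUidPr => _ ->; exists p0 => //.
    by have [_ _ []] := LP (p0, p0) Pp0 Pp0.
  have LK : \bigcup_(q in P) L (p0, q) `<=` K.
    by move=> y [q Pq]; have [_ + _ _ _] := LP (p0, q) Pp0 Pq; apply.
  apply: HD => //; [apply: dsub => //|].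
  - rewrite E sP; apply: peano_bigcup_seq => q qs.
    by have [|] := LP (p0, q) Pp0; rewrite ?sP//= => ? _ [].
  - by move=> q Pq; exists q => //; have [_ _ []] := LP (p0, q) Pp0 Pq.
have branch c : branches H x c -> exists2 p, P p & c = connected_component (H `\ x) p /\ c p.
  move=> [y [Hy yx] <-]; have [q Pq Lqy] := HL _ Hy.
  have [_ _ _ _ Lcut] := LP (p0, q) Pp0 Pq.
  have [||C [cC CL Cy nCx Cpq]] := Lcut x y _ _ Lqy yx.
  - by move=> E; apply: nPx; rewrite E.
  - by move=> E; apply: nPx; rewrite E.
  have CH : C `<=` H `\ x.
    by move=> z Cz; split; [exact: (LH p0 q Pp0 Pq _ (CL _ Cz))|move=> /= E; apply: nCx; rewrite -E].
  have mem p : C p -> connected_component (H `\ x) y p.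
    by move=> Cp; exists C.
  case: Cpq => [/mem|/mem] Cp; [exists p0|exists q] => //; split=> //;
    exact: same_connected_component.
have [p1 Pp1 [E1 m1]] := branch _ br1.
have [p2 Pp2 [E2 m2]] := branch _ br2.
have [p3 Pp3 [E3 m3]] := branch _ br3.
have bsep p q : P p -> P q ->
    connected_component (H `\ x) p <> connected_component (H `\ x) q -> sep K x p q.
  move=> Pp Pq npq A pA AK Ap Aq; apply: contrapT => nAx; apply: npq.
  have [[[_ _ connL] _] _ [Lp Lq] Lmin _] := LP (p, q) Pp Pq.
  apply: same_connected_component; exists (L (p, q)) => //; split=> //.
  move=> z Lz; split; first exact: LH Lz.
  by move=> /= E; apply: nAx; rewrite -E; exact: Lmin Lz.
rewrite E1 E2 E3 in c12 c13 c23.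
exists p1, p2, p3; split=> //; split; split; try (by move=> E; rewrite E in c12 c13 c23); exact: bsep.
Qed.

End main_tree_separation.

(** * The sprout and branch points *)

Section sprout.
Context {R : realType} {X : metricType R} {m : nat}.
Variables (S : 'I_m -> X -> X) (K : set X).
Hypothesis S_inj : forall i, injective (S i).
Hypothesis S_cont : forall i, continuous (S i).
Hypothesis K_eq : K = \bigcup_i (S i @` K).
Hypothesis dK : dendrite K.
Hypothesis finP : finite_set (boundary S K).

Local Notation P := (boundary S K).
Local Notation adj := (sprout_adj S K).

Lemma cell_sub i : S i @` K `<=` K.
Proof. by move=> x Kix; rewrite K_eq; exists i. Qed.

Lemma cell_cover x : K x -> exists i, (S i @` K) x.
Proof. by rewrite {1}K_eq => -[i _ Kix]; exists i. Qed.

Lemma peano_cell i : peano (S i @` K).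
Proof. by apply: peano_image => //; have [] := dK. Qed.

Lemma S_word_cat (u v : seq 'I_m) x : S_word S (u ++ v) x = S_word S u (S_word S v x).
Proof. exact: foldr_cat. Qed.

Lemma critical_preimage i y : K y -> critical_set S K (S i y) -> P y.
Proof. by move=> Ky Cy; split=> //; exists [:: i]. Qed.

Lemma black_preimage i y : K y -> black S K (S i y) -> P y.
Proof.
move=> Ky [|[_ [j j0 Cj]]]; first exact: critical_preimage.
by split=> //; exists (j ++ [:: i]); [case: (j) j0|rewrite S_word_cat].
Qed.

Lemma blackK x : black S K x -> K x.
Proof. by move=> [[i [_ [_ Kix _]]]|[]//]; exact: cell_sub Kix. Qed.

(** A critical point in K_i is the image under S_i of a boundary point, so the critical set lies in
    a finite union of images of P. *)
Lemma finite_critical : finite_set (critical_set S K).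
Proof.
apply: (@sub_finite_set _ _ (\bigcup_i (S i @` P))).
  move=> x [i [j [ij Kix Kjx]]]; exists i => //; case: (Kix) => y Ky yx.
  exists y => //; apply: (@critical_preimage i) => //.
  by rewrite yx; exists i, j.
by apply: bigcup_finite => [|i _]; [exact: finite_finset|exact: finite_image].
Qed.

(* The geometric counterpart of: p and b are connected in the sprout deprived of
   w_i. *)
Definition link i p b := p = b \/ exists A : set X,
  [/\ peano A, A `<=` \bigcup_(j in [set j | j != i]) (S j @` K), A p & A b].

Lemma link_sym i p b : link i p b -> link i b p.
Proof. by move=> [->|[A [? ? ? ?]]]; [left|right; exists A]. Qed.

Lemma link_trans i a p b : link i a p -> link i p b -> link i a b.
Proof.
move=> [->//|[A [pA AK Aa Ap]]] [<-|[A' [pA' A'K A'p A'b]]]; first by right; exists A.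
right; exists (A `|` A'); split; [|by rewrite subUset|by left|by right].
by apply: peanoU => //; exists p.
Qed.

Lemma link_cell i j p b : j != i -> (S j @` K) p -> (S j @` K) b -> link i p b.
Proof.
move=> ji pj bj; right; exists (S j @` K); split=> //; first exact: peano_cell.
by move=> z Kjz; exists j.
Qed.

Lemma away_sub i (A : set X) : A `<=` \bigcup_(j in [set j | j != i]) (S j @` K) ->
  A `<=` K.
Proof. by move=> AU z /AU[j _]; exact: cell_sub. Qed.

(* A point of the cell K_i on the connecting set would be critical, and the
   critical set is too small to contain an arc. *)
Lemma link_unique i b c : (S i @` K) b -> (S i @` K) c -> link i b c -> b = c.
Proof.
move=> Kb Kc [//|[A [pA AU Ab Ac]]]; apply: contrapT => bc.
have [g arcg gmin] := dendrite_arc dK (cell_sub Kb) (cell_sub Kc) bc.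
apply: (finite_arc arcg finite_critical) => z gz.
have Kiz : (S i @` K) z.
  by apply: (gmin _ (peano_cell i)) => //; exact: cell_sub.
have : A z by apply: (gmin _ pA) => //; exact: away_sub AU.
by move=> /AU[j /= ji Kjz]; exists j, i.
Qed.

(** The white vertices of the path are cells other than K_i, consecutive ones sharing a black
    vertex, so their union joins the ends away from K_i. The case of a white start serves the
    induction. *)
Lemma path_link i (s : seq (sprout_vertex (X := X))) u b :
  path adj u s -> last u s = inr b -> inl i \notin u :: s ->
  match u with inr p => link i p b
             | inl j => forall p, (S j @` K) p -> link i p b end.
Proof.
elim: s u => [|v s IHs] u /=.
  by move=> _ -> _; left.
move=> /andP[uv vs] lastb; rewrite inE negb_or => /andP[iu iv].
have := IHs _ vs lastb iv; move: uv.
case: u v {IHs vs lastb iv} iu => [j|p] [k|c] iu //=.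
  move=> /asboolP[_ Kjc] lcb p Kjp; apply: link_trans lcb.
  by apply: link_cell Kjp Kjc; apply: contraNneq iu => ->.
by move=> /asboolP[_ Kkp]; exact.
Qed.

(** * Connectedness of the sprout and the points of entry into cells *)

Definition reach (u v : sprout_vertex (X := X)) :=
  exists2 s, path adj u s & last u s = v.

Lemma reach_trans u v w : reach u v -> reach v w -> reach u w.
Proof.
move=> [s us sv] [t vt tw]; exists (s ++ t); last by rewrite last_cat sv.
by rewrite cat_path us sv.
Qed.

Lemma reach_adj u v : adj u v -> reach u v.
Proof. by move=> uv; exists [:: v] => //=; rewrite uv. Qed.

(** The union of the cells reachable from w_i and the union of the remaining ones are closed and
    cover K. They are disjoint, since a common point would be critical, hence a black vertex joining
    two such cells; connectedness of K concludes. *)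
Lemma reach_white i j : reach (inl i) (inl j).
Proof.
pose U (Q : 'I_m -> Prop) := \bigcup_(k in [set k | Q k]) (S k @` K).
have closedU Q : closed (U Q).
  apply: closed_bigcup; first exact: finite_finset.
  by move=> k _; apply: peano_closed; exact: peano_cell.
have [[K0 _ connK] _ _] := dK.
have KU : U (fun k => reach (inl i) (inl k)) = K.
  apply: connK.
  - have [x Kx] := K0; exists (S i x).
    by exists i; [exists [::]|exists x].
  - exists (~` U (fun k => ~ reach (inl i) (inl k))); first exact: closed_openC.
    apply/seteqP; split=> [x [k /= rk Kkx]|x [Kx nU]].
      split; first exact: cell_sub Kkx.
      move=> [l /= nrl Klx]; apply: nrl; apply: reach_trans (rk) _.
      have [<-|kl] := eqVneq k l; first by exists [::].
      have bx : black S K x by left; exists k, l.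
      by apply: (@reach_trans _ (inr x)); apply: reach_adj; apply/asboolP.
    have [k Kkx] := cell_cover Kx; exists k => //=.
    by apply: contrapT => nr; apply: nU; exists k.
  - exists (U (fun k => reach (inl i) (inl k))) => //.
    by apply/esym/setIidPr => x [k _]; exact: cell_sub.
have [x Kx] := K0; have : K (S j x) by apply: (@cell_sub j); exists x.
rewrite -{1}KU => -[k /= rk Kkx]; apply: reach_trans rk _.
have [<-|kl] := eqVneq k j; first by exists [::].
have Kjx : (S j @` K) (S j x) by exists x.
have bx : black S K (S j x) by left; exists k, j.
by apply: (@reach_trans _ (inr (S j x))); apply: reach_adj; apply/asboolP.
Qed.

Lemma reach_black p i : black S K p -> reach (inr p) (inl i).
Proof.
move=> bp; have [j Kjp] := cell_cover (blackK bp).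
by apply: (reach_trans _ (reach_white j i)); apply: reach_adj; apply/asboolP.
Qed.

Lemma sprout_labelP i b : (S i @` K) b ->
  K (sprout_label S K i b) /\ S i (sprout_label S K i b) = b.
Proof.
move=> [y Ky yb]; rewrite /sprout_label; case: xgetP => [q _ []//|/(_ y)].
by case; split.
Qed.

Lemma simple_path_white p i : black S K p -> exists s b,
  [/\ path adj (inr p) (rcons s (inl i)), uniq (inr p :: rcons s (inl i)),
      last (inr p) s = inr b & black S K b /\ (S i @` K) b].
Proof.
move=> bp; have [s ps slast] := reach_black i bp.
move: ps slast; case/shortenP => s' + us' _; case/lastP: s' us' => // s' v us' ps'.
rewrite last_rcons => vE; rewrite vE in us' ps'.
move: (ps'); rewrite rcons_path => /andP[_].
case E: (last _ s') => [j|b]//= /asboolP bKb.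
by exists s', b.
Qed.

(** The path defining [phi] avoids w_i before its last edge, so its last black vertex is linked to
    p. Reachability in the sprout rules out the default value of [xget]. *)
Lemma phi_spec i p : black S K p ->
  [/\ K (phi S K i p), black S K (S i (phi S K i p)) &
      link i p (S i (phi S K i p))].
Proof.
move=> bp; rewrite /phi; case: xgetP => [q _|].
  move=> [s [b [ps us sb ->]]].
  have [bb Kib] : black S K b /\ (S i @` K) b.
    by move: ps; rewrite rcons_path sb => /andP[_ /= /asboolP].
  have [? ->] := sprout_labelP Kib; split=> //.
  move: ps us; rewrite rcons_path => /andP[ps _].
  rewrite -rcons_cons rcons_uniq => /andP[iu _].
  exact: path_link ps sb iu.
move=> nE; exfalso; have [s [b [ps us sb _]]] := simple_path_white i bp.
by apply: (nE (sprout_label S K i b)); exists s, b.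
Qed.

(** This computes [phi] from a link alone, without exhibiting a path of the sprout. *)
Lemma entry_unique i p b : black S K p -> (S i @` K) b -> link i p b ->
  S i (phi S K i p) = b.
Proof.
move=> bp Kib lpb; have [Kphi _ lphi] := phi_spec i bp.
apply: (@link_unique i) => //.
exact: link_trans (link_sym lphi) lpb.
Qed.

Lemma phi_boundary i p : P p -> P (phi S K i p).
Proof.
move=> Pp; have bp : black S K p by right.
by have [Kphi bphi _] := phi_spec i bp; exact: black_preimage Kphi bphi.
Qed.

(** * Transport of branch points under the maps phi *)

Lemma sep_refl x p : K p -> sep K x p p -> x = p.
Proof.
by move=> Kp sp; apply: (sp [set p]) => //; [exact: peano1|move=> _ ->].
Qed.

(** If A joins the two images, then S_i (A) together with the links from p and q to their entry
    points joins p and q, hence contains S_i y. A link meets K_i only at the entry point, so S_i y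
    already lies in S_i (A). *)
Lemma sep_step i y p q : K y -> P p -> P q -> sep K (S i y) p q ->
  sep K y (phi S K i p) (phi S K i q).
Proof.
move=> Ky Pp Pq sepx A pA AK Ap Aq.
have Kiy : (S i @` K) (S i y) by exists y.
have cell_avoid r B : P r -> peano B ->
    B `<=` \bigcup_(j in [set j | j != i]) (S j @` K) -> B r ->
    B (S i y) -> S i y = S i (phi S K i r).
  move=> Pr pB BU Br By; apply/esym/entry_unique => //; first by right.
  by right; exists B.
have SA r : A r -> (S i @` A) (S i r) by exists r.
have SAK : S i @` A `<=` K by move=> _ [z /AK Kz <-]; apply: (@cell_sub i); exists z.
have pSA : peano (S i @` A) by exact: peano_image.
have lk r : P r -> A (phi S K i r) -> forall C, peano C -> C `<=` K -> C (S i (phi S K i r)) ->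
    exists D, [/\ peano D, D `<=` K, C `<=` D, D r &
      D (S i y) -> C (S i y) \/ S i y = S i (phi S K i r)].
  move=> Pr Ar C pC CK Cr; have [_ _ [E|[B [pB BU Br Be]]]] := phi_spec i (or_intror Pr : black S K r).
    by exists C; split=> //; [rewrite E|left].
  exists (C `|` B); split.
  - by apply: peanoU => //; exists (S i (phi S K i r)).
  - by rewrite subUset; split=> //; exact: away_sub BU.
  - by left.
  - by right.
  - by move=> [?|?]; [left|right; exact: (cell_avoid r B)].
have [D [pD DK SD Dp Dy]] := lk p Pp Ap _ pSA SAK (SA _ Ap).
have [E [pE EK DE Eq Ey]] := lk q Pq Aq _ pD DK (SD _ (SA _ Aq)).
have Ex : E (S i y) by apply: sepx => //; exact: DE.
have [/Dy[[z Az /S_inj <-]//|/S_inj ->//]|/S_inj ->//] := Ey Ex.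
Qed.

(** K_i with the links from p and q to their entry points is a Peano continuum through p and q; as z
    is not in K_i, it lies on a link. *)
Lemma sep_escape i z p q : ~ (S i @` K) z -> P p -> P q -> sep K z p q ->
  link i p z \/ link i q z.
Proof.
move=> nKz Pp Pq sepz.
have lk r : P r -> forall C, peano C -> C `<=` K -> S i @` K `<=` C ->
    exists D, [/\ peano D, D `<=` K, C `<=` D, D r & D z -> C z \/ link i r z].
  move=> Pr C pC CK KC; have [Kr _ [E|[B [pB BU Br Be]]]] := phi_spec i (or_intror Pr : black S K r).
    by exists C; split=> //; [rewrite E; apply: KC; exists (phi S K i r)|left].
  exists (C `|` B); split.
  - by apply: peanoU => //; exists (S i (phi S K i r)); split=> //; apply: KC; exists (phi S K i r).
  - by rewrite subUset; split=> //; exact: away_sub BU.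
  - by left.
  - by right.
  - by move=> [?|?]; [left|right; right; exists B].
have [D [pD DK KD Dp Dz]] := lk p Pp _ (peano_cell i) (@cell_sub i) (fun x h => h).
have [E [pE EK DE Eq Ez]] := lk q Pq _ pD DK KD.
by have [/Dz[//|]|] := Ez (sepz _ pE EK (DE _ Dp) Eq); [left|right].
Qed.

(* S_j (phi_j p) is the point through which p enters K_j; it differs from x exactly
   for the cell K_j by which p reaches x. *)
Lemma direction x p : black S K x -> P p -> p <> x ->
  exists2 j, (S j @` K) x & S j (phi S K j p) <> x.
Proof.
move=> bx Pp px; have bp : black S K p by right.
have [i Kix] := cell_cover (blackK bx).
have [s ps slast] : reach (inr p) (inr x).
  apply: (reach_trans (reach_black i bp)); apply: reach_adj.
  by apply/asboolP.
move: ps slast; case/shortenP => s' + us' _; case/lastP: s' us' => [|s' v us' ps'] /=.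
  by move=> _ _ [].
rewrite last_rcons => vE; rewrite vE in us' ps'.
move: ps' us'; rewrite rcons_path -rcons_cons rcons_uniq => /andP[ps' +] /andP[xs us'].
case/lastP: s' ps' xs us' => [//|s' u]; rewrite last_rcons rcons_path.
case: u => // j /andP[ps' adju] xs us' /asboolP[_ Kjx]; exists j => //.
case E : (last (inr p) s') adju => [//|b] /= /asboolP[bb Kjb].
suff -> : S j (phi S K j p) = b.
  move=> bx'; move: xs; rewrite -bx' -rcons_cons mem_rcons inE negb_or => /andP[_].
  by rewrite -E mem_last.
apply: entry_unique => //; apply: (path_link ps' E).
by move: us'; rewrite -rcons_cons rcons_uniq => /andP[].
Qed.

(** Without w_j in T, the path in T from p to q would link them away from K_j, and both would enter
    K_j at the same point. *)
Lemma subtree_direction (T : set sprout_vertex) x p q j :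
  is_tree adj T -> T `<=` sprout_vertices S K -> T (inr p) -> T (inr q) -> P p -> black S K q ->
  (S j @` K) x -> S j (phi S K j p) <> x -> S j (phi S K j q) = x -> T (inl j).
Proof.
move=> [_ Tconn _] TW Tp Tq Pp bq Kjx px qx.
have [s [ps slast sT]] := Tconn _ _ Tp Tq.
apply: contrapT => nTj; apply: px.
have [_ _ lqx] := phi_spec j bq.
apply: entry_unique => //; first by right.
rewrite qx in lqx; apply: link_trans lqx.
apply: (path_link ps slast); rewrite inE/=; apply/negP => js.
by apply: nTj; exact: sT.
Qed.

(** The first black vertex c on a simple path from w_j to w_k is linked to x away from K_j; since
    both lie in K_j, they coincide. *)
Lemma subtree_center (T : set sprout_vertex) x j k :
  is_tree adj T -> T `<=` sprout_vertices S K -> T (inl j) -> T (inl k) -> j <> k ->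
  (S j @` K) x -> (S k @` K) x -> T (inr x).
Proof.
move=> [_ Tconn _] TW Tj Tk jk Kjx Kkx; have [s [ps slast sT]] := Tconn _ _ Tj Tk.
move: ps slast sT; case/shortenP => s' + us' ss' + sT.
case: s' us' ss' => [|v s'] us' ss' /=.
  by move=> _ [].
case: v us' ss' => [//|c] us' ss' /andP[/asboolP[bc Kjc] ps'] slast.
suff -> : x = c by apply: sT; apply: ss'; exact: mem_head.
have bx : black S K x by left; exists j, k; split=> //; exact/eqP.
apply: (@link_unique j) => //; apply: link_sym.
apply: (@path_link j (rcons s' (inr x)) (inr c)).
- by rewrite rcons_path ps' slast; apply/asboolP.
- by rewrite last_rcons.
- move: us'; rewrite -rcons_cons mem_rcons !inE => /andP[+ _].
  by rewrite inE negb_or.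
Qed.

(* y is the branch point of three points of Q, possibly one of them. *)
Definition tripod y (Q : set X) := exists q : 'I_3 -> X,
  [/\ forall a, Q (q a), injective q & forall a b, a != b -> sep K y (q a) (q b)].

Lemma tripod_card y (Q : set X) : tripod y Q -> Q #>= `I_3.
Proof.
move=> [q [Qq qinj _]]; apply: (@card_ge_inj _ _ _ (fun i => q (inord i))).
  by move=> i _; exact: Qq.
move=> i j /set_mem i3 /set_mem j3 /qinj /(congr1 val).
by rewrite /= !inordK.
Qed.

(** Two coinciding images would still be separated by y, hence both equal y, which the last
    hypothesis excludes. *)
Lemma tripod_step i y (Q : set X) (q : 'I_3 -> X) : K y -> Q `<=` P ->
  (forall a, Q (q a)) ->
  (forall a b, a != b -> sep K (S i y) (q a) (q b)) ->
  (forall a b, a != b -> phi S K i (q a) = y -> phi S K i (q b) <> y) ->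
  tripod y (phi S K i @` Q).
Proof.
move=> Ky QP Qq qsep qy.
have psep a b : a != b -> sep K y (phi S K i (q a)) (phi S K i (q b)).
  by move=> ab; apply: sep_step => //; [exact/QP/Qq|exact/QP/Qq|exact: qsep].
exists (fun a => phi S K i (q a)); split=> //.
  by move=> a; exists (q a) => //; exact: Qq.
move=> a b Eab; apply/eqP; apply/negP => /negP ab.
have Kphi : K (phi S K i (q b)).
  by have [] := phi_spec i (or_intror (QP _ (Qq b)) : black S K (q b)).
have := psep _ _ ab; rewrite Eab => /(sep_refl Kphi) yE.
by apply: (qy _ _ ab); rewrite ?Eab.
Qed.

Lemma ord3_distinct : exists a b c : 'I_3, [/\ a != b, a != c & b != c].
Proof.
by exists (inord 0), (inord 1), (inord 2); split; rewrite -(inj_eq val_inj) /= !inordK.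
Qed.

Lemma ord3_third (a b c d : 'I_3) : a != b -> c != d ->
  [|| c == a, c == b, d == a | d == b].
Proof.
rewrite -!(inj_eq val_inj) /=; have := ltn_ord a; have := ltn_ord b.
by have := ltn_ord c; have := ltn_ord d; lia.
Qed.

Lemma hull_mem (Q : set X) v :
  (forall T, is_tree adj T -> T `<=` sprout_vertices S K ->
     (forall q, Q q -> T (inr q)) -> T v) -> sprout_hull S K Q v.
Proof.
move=> Tv T [[treeT TW] QT]; apply: Tv => // q Qq; apply: QT.
by exists q.
Qed.

(* If no cell through y is entered off y by two of the three points, then the
   points leave y in pairwise different directions. *)
Lemma tripod_cases y (Q : set X) : K y -> Q `<=` P -> tripod y Q ->
  [\/ exists i y', [/\ K y', y = S i y' & tripod y' (phi S K i @` Q)],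
      [/\ black S K y, ~ Q y & neighbours S K (sprout_hull S K Q) (inr y) #>= `I_3] |
      Q y /\ neighbours S K (sprout_hull S K Q) (inr y) #>= `I_2].
Proof.
move=> Ky QP [q [Qq qinj qsep]].
have bq a : black S K (q a) by right; exact/QP/Qq.
(* Entry points are black, so if y is not black, every cell containing y can be used. *)
have [by_|nby] := pselect (black S K y); last first.
  constructor 1; have [i [y' Ky' yE]] := cell_cover Ky; exists i, y'; split=> //.
  apply: (tripod_step (q := q)) => //; first by rewrite yE.
  move=> a b _ ay _; apply: nby; have [_ + _] := phi_spec i (bq a).
  by rewrite ay yE.
(* If two of the three points enter K_j off y, at most one image is the preimage of y, and
   [tripod_step] applies. *)
have [[j [a [b [ab Kjy aj bj]]]]|nj] := pselect (exists j a b,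
    [/\ a != b, (S j @` K) y, S j (phi S K j (q a)) <> y & S j (phi S K j (q b)) <> y]).
  constructor 1; have [y' Ky' yE] := Kjy; exists j, y'; split=> //.
  apply: (tripod_step (q := q)) => //; first by rewrite yE.
  move=> c d cd cy dy.
  have ny e : phi S K j (q e) = y' -> e != a /\ e != b.
    by move=> ey; split; apply/eqP => E; [apply: aj|apply: bj]; rewrite -E ey.
  have [ca cb] := ny _ cy; have [da db] := ny _ dy.
  by have := ord3_third ab cd; rewrite (negPf ca) (negPf cb) (negPf da) (negPf db).
(* In the remaining case each cell through y is entered off y by at most one of the three points.
   The cells [j a] chosen below are therefore distinct, and they are the neighbours of y to be
   counted in the hull of Q. *)
have entry j a b : a != b -> (S j @` K) y -> S j (phi S K j (q a)) <> y ->
    S j (phi S K j (q b)) = y.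
  by move=> ab Kjy aj; apply: contrapT => bj; apply: nj; exists j, a, b.
have dirs a : exists j, q a <> y -> (S j @` K) y /\ S j (phi S K j (q a)) <> y.
  have [E|qay] := pselect (q a = y); first by have [j _] := cell_cover Ky; exists j.
  by have [j ? ?] := direction by_ (QP _ (Qq a)) qay; exists j.
have [j jP] := choice dirs.
have jinj a b : a != b -> q a <> y -> q b <> y -> j a <> j b.
  move=> ab /jP[Kay ay] /jP[Kby byy] E; apply: byy; rewrite -E.
  exact: (entry (j a) a b).
have hull_white a b : a != b -> q a <> y -> sprout_hull S K Q (inl (j a)).
  move=> ab qay; have [Kjy ay] := jP _ qay.
  apply: hull_mem => T treeT TW QT.
  apply: (subtree_direction treeT TW (QT _ (Qq a)) (QT _ (Qq b)) _ _ Kjy ay) => //.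
    exact/QP/Qq.
  exact: (entry (j a) a b).
have adj_y a : q a <> y -> adj (inr y) (inl (j a)).
  by move=> /jP[Kjy _]; apply/asboolP.
have [Qy|nQy] := pselect (Q y).
  constructor 3; split=> //; apply/card_ge2P.
  have hy : sprout_hull S K Q (inr y) by apply: hull_mem => T _ _; apply.
  have [a [b [ab qay qby]]] : exists a b, [/\ a != b, q a <> y & q b <> y].
    have [e0 [e1 [e2 [e01 e02 e12]]]] := ord3_distinct.
    have [E0|n0] := pselect (q e0 = y).
      exists e1, e2; split=> //; rewrite -E0 => /qinj E; last by rewrite E eqxx in e02.
      by rewrite E eqxx in e01.
    have [E1|n1] := pselect (q e1 = y); last by exists e0, e1.
    exists e0, e2; split=> //; rewrite -E1 => /qinj E.
    by rewrite E eqxx in e12.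
  exists (inl (j a)), (inl (j b)); split.
  - by split; [|exact: (hull_white a b)|exact: adj_y].
  - by split; [|apply: (hull_white b a); rewrite // eq_sym|exact: adj_y].
  - by move=> [E]; exact: (jinj a b).
constructor 2; split=> //; apply/card_ge3P.
have qy a : q a <> y by move=> E; apply: nQy; rewrite -E.
have [e0 [e1 [e2 [e01 e02 e12]]]] := ord3_distinct.
have hy : sprout_hull S K Q (inr y).
  apply: hull_mem => T treeT TW QT.
  have Tj a b : a != b -> T (inl (j a)).
    by move=> ab; apply: (hull_white a b ab (qy a)); split=> // _ [z Qz <-]; exact: QT.
  apply: (@subtree_center T y (j e0) (j e1)) => //.
  - exact: Tj e01.
  - by apply: (Tj _ e0); rewrite eq_sym.
  - exact: jinj.
  - by have [] := jP _ (qy e0).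
  - by have [] := jP _ (qy e1).
have nb a b : a != b -> neighbours S K (sprout_hull S K Q) (inr y) (inl (j a)).
  by move=> ab; split; [|exact: (hull_white a b)|exact: adj_y].
exists (inl (j e0)), (inl (j e1)), (inl (j e2)); split; split.
- exact: nb e01.
- exact: nb e12.
- by apply: (nb _ e1); rewrite eq_sym.
- by move=> [E]; exact: (jinj _ _ e01).
- by move=> [E]; exact: (jinj _ _ e02).
- by move=> [E]; exact: (jinj _ _ e12).
Qed.

(** If z were off K_i, every pair of the three points would contain one linked to z, hence two of
    them would be, and these would enter K_i at the same point, against injectivity. With z in K_i,
    injectivity gives the last hypothesis of [tripod_step]. *)
Lemma tripod_inj_step i z (Q : set X) : K z -> Q `<=` P -> tripod z Q ->
  {in Q &, injective (phi S K i)} ->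
  exists z', [/\ K z', z = S i z' & tripod z' (phi S K i @` Q)].
Proof.
move=> Kz QP [q [Qq qinj qsep]] iinj.
have bq a : black S K (q a) by right; exact/QP/Qq.
have entry_inj a b : S i (phi S K i (q a)) = S i (phi S K i (q b)) -> a = b.
  by move=> /S_inj /iinj E; apply: qinj; apply: E; apply: mem_set.
have [[z' Kz' zE]|nKz] := pselect ((S i @` K) z).
  exists z'; split=> //; apply: (tripod_step (q := q)) => //.
    by move=> a b /qsep; rewrite zE.
  move=> a b ab az bz; move/eqP: ab; apply; apply: entry_inj.
  by rewrite az bz.
exfalso.
have esc a b : a != b -> link i (q a) z \/ link i (q b) z.
  by move=> ab; apply: sep_escape => //; [exact/QP/Qq|exact/QP/Qq|exact: qsep].
have nboth a b : a != b -> link i (q a) z -> ~ link i (q b) z.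
  move=> ab az bz; move/eqP: ab; apply; apply: entry_inj.
  have [Ka _ la] := phi_spec i (bq a); have [Kb _ lb] := phi_spec i (bq b).
  apply: (@link_unique i); [by exists (phi S K i (q a))|by exists (phi S K i (q b))|].
  exact: link_trans (link_trans (link_sym la) az) (link_trans (link_sym bz) lb).
have [e0 [e1 [e2 [e01 e02 e12]]]] := ord3_distinct.
have [h0|h1] := esc _ _ e01.
  by have [h1|h2] := esc _ _ e12; [exact: nboth e01 h0 h1|exact: nboth e02 h0 h2].
by have [h0|h2] := esc _ _ e02; [exact: nboth e01 h0 h1|exact: nboth e12 h1 h2].
Qed.

End sprout.

(** * Addresses *)

Section addresses.
Context {R : realType} {X : metricType R} {m : nat}.
Variables (S : 'I_m -> X -> X) (K : set X).
Implicit Types (x y z : X) (alpha beta : nat -> 'I_m).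

Lemma contractive_continuous (f : X -> X) : contractive f -> continuous f.
Proof.
move=> [q /andP[q0 q1] fq] x; apply/metricType_numDomainType.cvgrPdist_lt => e e0.
near=> y; apply: le_lt_trans (fq _ _) _; apply: (@le_lt_trans _ _ (mdist x y)).
  by rewrite ler_piMl ?mdist_ge0// ltW.
by near: y; apply: open_nbhs_nbhs; split; [exact: mdist_open|rewrite /= mdistxx].
Unshelve. all: by end_near. Qed.

Lemma S_word_rcons (w : seq 'I_m) i x : S_word S (rcons w i) x = S_word S w (S i x).
Proof. by rewrite /S_word foldr_rcons. Qed.

Hypothesis S_contr : forall i, contractive (S i).
Hypothesis K_attr : is_attractor S K.

Lemma S_word_contractive : exists2 q : R, 0 <= q < 1 &
  forall (w : seq 'I_m) x y, mdist (S_word S w x) (S_word S w y) <= q ^+ size w * mdist x y.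
Proof.
have /choice[c cP] : forall i, exists q : R, 0 <= q < 1 /\
    forall x y, mdist (S i x) (S i y) <= q * mdist x y.
  by move=> i; have [q ? ?] := S_contr i; exists q.
pose q : R := \big[Num.max/0]_(i < m) c i.
have q0 : 0 <= q by exact: bigmax_ge_id.
exists q.
  by rewrite q0/=; apply: bigmax_lt => // i _; have [/andP[]] := cP i.
elim=> [|i w IHw] x y /=; first by rewrite mul1r.
have [_ ci] := cP i; apply: le_trans (ci _ _) _.
rewrite exprS -mulrA; apply: ler_pM => //; [by have [/andP[]] := cP i|exact: mdist_ge0|].
exact: le_bigmax.
Qed.

(** The diameters of the cells of level n are at most q ^+ n times that of K, for the largest
    contraction ratio q. *)
Lemma address_of_cells alpha x : (forall n, K_word S K (mkseq alpha n) x) ->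
  is_address S K alpha x.
Proof.
move=> xK; apply/seteqP; split=> [y yK|_ -> n _]; last exact: xK.
have [_ cK _] := K_attr; have [D KD] := compact_mdist_bounded cK.
have [q /andP[q0 q1] qP] := S_word_contractive.
have D0 : 0 <= D.
  by have [x0 Kx0 _] := xK 0%N; exact: le_trans (mdist_ge0 _ _) (KD _ _ Kx0 Kx0).
have bound n : mdist y x <= q ^+ n * D.
  have [u Ku <-] := yK n I; have [v Kv <-] := xK n.
  apply: le_trans (qP _ _ _) _; rewrite size_mkseq ler_wpM2l ?exprn_ge0//.
  exact: KD.
apply: mdist_small_eq => e e0.
have qe : \forall n \near \oo, q ^+ n < e / (D + 1).
  have qcvg := @cvg_expr R q; rewrite ger0_norm// in qcvg.
  have eD : 0 < e / (D + 1) by rewrite divr_gt0// ltr_wpDl.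
  have /cvgrPdist_lt/(_ _ eD) := qcvg q1; apply: filterS => n.
  by rewrite sub0r normrN ger0_norm ?exprn_ge0.
have [n _ /(_ n (leqnn n)) qn] := qe.
apply: le_lt_trans (bound n) _.
move: qn; rewrite /= ltr_pdivlMr ?ltr_wpDl// => qn.
apply: (@lt_trans _ _ e); last by lra.
by apply: le_lt_trans qn; rewrite ler_wpM2l ?exprn_ge0// lerDl.
Qed.

Lemma exists_address x : K x -> exists alpha, is_address S K alpha x.
Proof.
move=> Kx; have [_ _ K_eq] := K_attr.
have /choice[F FP] : forall y, exists iz : 'I_m * X,
    K y -> K iz.2 /\ y = S iz.1 iz.2.
  move=> y; have [Ky|nKy] := pselect (K y).
    by have := Ky; rewrite {1}K_eq => -[i _ [z Kz <-]]; exists (i, z).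
  by have := Kx; rewrite {1}K_eq => -[i _ _]; exists (i, y).
pose orb n := iter n (fun y => (F y).2) x.
have Korb n : K (orb n) by elim: n => //= n /FP[].
exists (fun n => (F (orb n)).1); apply: address_of_cells => n.
exists (orb n) => //; elim: n => // n IHn.
rewrite mkseqS S_word_rcons; have [_ orbE] := FP _ (Korb n).
by rewrite [orb n.+1]/(F (orb n)).2 -orbE.
Qed.

Definition cons_address i alpha : nat -> 'I_m := fun n => if n is n'.+1 then alpha n' else i.

Lemma cons_addressP i alpha y : is_address S K alpha y -> K y ->
  is_address S K (cons_address i alpha) (S i y).
Proof.
move=> ay Ky; apply: address_of_cells => -[|n].
  have [_ _ K_eq] := K_attr; exists (S i y) => //.
  by rewrite K_eq; exists i => //; exists y.
have -> : mkseq (cons_address i alpha) n.+1 = i :: mkseq alpha n.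
  by rewrite /mkseq /= (iotaDl 1 0) -map_comp.
have : (\bigcap_n K_word S K (mkseq alpha n)) y by rewrite ay.
by move=> /(_ n I)[z Kz <-]; exists z.
Qed.

Lemma S_word_mem (w : seq 'I_m) y : K y -> K (S_word S w y).
Proof.
have [_ _ K_eq] := K_attr.
by move=> Ky; elim: w => //= i w IHw; rewrite K_eq; exists i => //; exists (S_word S w y).
Qed.

(** The point b has an address starting with i and another starting with j; a common prefix w keeps
    them different. *)
Lemma two_addresses (w : seq 'I_m) b i j : i != j -> (S i @` K) b -> (S j @` K) b ->
  ~ exists! alpha, is_address S K alpha (S_word S w b).
Proof.
move=> ij [y Ky yb] [z Kz zb].
have [alpha ay] := exists_address Ky; have [beta bz] := exists_address Kz.
have [_ _ K_eq] := K_attr.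
have Kb : K b by rewrite K_eq; exists i => //; exists y.
have [al [be [aw bw ab]]] : exists al be, [/\ is_address S K al (S_word S w b),
    is_address S K be (S_word S w b) & al <> be].
  elim: w => /= [|k w [al [be [aw bw ab]]]].
    exists (cons_address i alpha), (cons_address j beta); split.
    - by rewrite -yb; exact: cons_addressP.
    - by rewrite -zb; exact: cons_addressP.
    - by move=> /(congr1 (fun f => f 0%N)) /= E; rewrite E eqxx in ij.
  exists (cons_address k al), (cons_address k be); split.
  - by apply: cons_addressP => //; exact: S_word_mem.
  - by apply: cons_addressP => //; exact: S_word_mem.
  - move=> E; apply: ab; apply/funext => n.
    by have := congr1 (fun f => f n.+1) E.
by move=> [c [_ cP]]; apply: ab; rewrite -(cP _ aw) -(cP _ bw).
Qed.

End addresses.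

(** * Walks in the transformation graph *)

(** The least N is taken so that the vertices on the initial path and on the cycle are distinct. *)
Lemma first_repetition (T : Type) (f : nat -> T) : ~ injective f ->
  exists n N, [/\ (n < N)%N, f n = f N & set_inj `I_N f].
Proof.
move=> ninj.
have ex : exists N, `[< exists2 n, (n < N)%N & f n = f N >].
  apply: contrapT => nex; apply: ninj => a b ab.
  have [lt_ab|lt_ba|//] := ltngtP a b.
    by case: nex; exists b; apply/asboolP; exists a.
  by case: nex; exists a; apply/asboolP; exists b.
have [N /asboolP[n nN fnN] Nmin] := ex_minnP ex.
exists n, N; split=> // a b /set_mem aN /set_mem bN ab.
have [lt_ab|lt_ba|//] := ltngtP a b.
  have : (N <= b)%N by apply: Nmin; apply/asboolP; exists a.
  by rewrite leqNgt bN.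
have : (N <= a)%N by apply: Nmin; apply/asboolP; exists b.
by rewrite leqNgt aN.
Qed.

Lemma finite_subsets_repeat (T : choiceType) (P : set T) (Q : nat -> set T) :
  finite_set P -> (forall n, Q n `<=` P) -> ~ injective Q.
Proof.
move=> finP QP Qinj; apply: infinite_nat.
have finQ n : finite_set (Q n) := sub_finite_set (QP n) finP.
pose F n := fset_set (Q n).
have : finite_set (F @^-1` [set` fpowerset (fset_set P)]).
  apply: finite_preimage; last exact: finite_fset.
  by move=> i j _ _ /fset_set_inj E; apply: Qinj; apply: E.
congr finite_set; apply/seteqP; split=> // n _ /=.
by rewrite fpowersetE -fset_set_sub.
Qed.

(** Cardinalities cannot increase along the maps, and Q n = Q N forces them to be constant in
    between. *)
Lemma cycle_maps_injective (T : choiceType) (Q : nat -> set T) (f : nat -> T -> T) n N :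
  (forall t, finite_set (Q t)) -> (forall t, f t @` Q t = Q t.+1) -> Q n = Q N ->
  forall t, (n <= t < N)%N -> {in Q t &, injective (f t)}.
Proof.
move=> finQ fQ QnN t /andP[nt tN].
pose c t := #|` fset_set (Q t)|%fset.
have cS s : (c s.+1 <= c s)%N.
  by rewrite /c -fQ fset_set_image// leq_imfset_card.
have cmono a b : (a <= b)%N -> (c b <= c a)%N.
  by move=> /subnKC <-; elim: (b - a)%N => [|k IHk]; rewrite ?addn0// addnS (leq_trans (cS _)).
have cE : c t.+1 = c t.
  apply/eqP; rewrite eqn_leq cS/=; apply: leq_trans (cmono _ _ tN).
  by rewrite {2}/c -QnN; exact: cmono.
move: cE => /eqP; rewrite /c -fQ fset_set_image// => /card_in_imfsetP inj_t a b Qa Qb.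
by apply: inj_t; rewrite in_fset_set.
Qed.

Section walks_lemmas.
Context {V E : Type} (edge : set E) (src tgt : E -> V).

Lemma fin_walk_from_cat v s t : fin_walk_from edge src tgt v (s ++ t) <->
  fin_walk_from edge src tgt v s /\ fin_walk_from edge src tgt (last v (map tgt s)) t.
Proof.
elim: s v => [|e s IHs] v /=; first by split=> [|[]].
by split=> [[? ? /IHs[? ?]]|[[? ? ?] ?]]; split=> //; apply/IHs.
Qed.

Lemma maximal_dead_end v s e : fin_walk_from edge src tgt v (rcons s e) ->
  (forall e', tgt e <> src e') ->
  maximal_walk_from edge src tgt v (FinWalk (rcons s e)).
Proof.
move=> ws dead; split=> // -[s'|f] /= ws'.
  move=> [[|e' t] sE]; first by rewrite sE cats0.
  move: ws'; rewrite sE => /fin_walk_from_cat[_ /= [_ + _]].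
  by rewrite map_rcons last_rcons => /esym/dead.
rewrite size_rcons mkseqS => /rcons_inj[_ eE].
by case: (dead (f (size s).+1)); rewrite eE; have [] := ws'.2 (size s).
Qed.

End walks_lemmas.

(** * Descent of a branch point through the cells *)

Section transformation_graph.
Context {R : realType} {X : metricType R} {m : nat}.
Variables (S : 'I_m -> X -> X) (K : set X).
Hypothesis S_inj : forall i, injective (S i).
Hypothesis S_contr : forall i, contractive (S i).
Hypothesis K_attr : is_attractor S K.
Hypothesis dK : dendrite K.
Hypothesis finP : finite_set (boundary S K).

Local Notation P := (boundary S K).
Local Notation src := (@gt_src R X m).
Local Notation tgt := (@gt_tgt R X m).
Local Notation Qw w := (phi_word S K w @` P).

Let S_cont i : continuous (S i) := contractive_continuous (S_contr i).
Let K_eq : K = \bigcup_i (S i @` K).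
Proof. by have [] := K_attr. Qed.

Lemma phi_word_rcons w i : Qw (rcons w i) = phi S K i @` (Qw w).
Proof.
by rewrite image_comp; congr image; apply/funext => p; rewrite /phi_word foldl_rcons.
Qed.

Lemma phi_word_nil : Qw [::] = P.
Proof. exact: image_id. Qed.

Lemma phi_word_sub w : Qw w `<=` P.
Proof.
elim/last_ind: w => [|w i IHw]; first by rewrite phi_word_nil.
rewrite phi_word_rcons => _ [p /IHw Pp <-].
exact: (phi_boundary S_inj S_cont K_eq dK).
Qed.

Lemma gt_vertexQ w y : tripod K y (Qw w) -> gt_vertices S K (VQ (Qw w)).
Proof. by move=> /tripod_card cQ; split=> //; [exact: phi_word_sub|exists w]. Qed.

Definition trace_walk w (s : seq (gt_edge X m)) :=
  [/\ fin_walk_from (gt_edges S K) src tgt (VQ P) s,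
      edges_of (FinWalk s) `<=` @in_EQ R X m,
      pmap (@gt_label R X m) s = w & last (VQ P) (map tgt s) = VQ (Qw w)].

(** The invariant of the descent from x: after the word w, the point y is what remains of x inside
    the cell of w, and w is read off a walk from P. *)
Definition state x w y := [/\ x = S_word S w y, K y, tripod K y (Qw w) &
  exists s, trace_walk w s].

Lemma state_nil x : K x -> tripod K x P -> state x [::] x.
Proof.
move=> Kx tx; split=> //; first by rewrite phi_word_nil.
by exists [::]; split=> //=; rewrite phi_word_nil.
Qed.

Lemma state_step x w y i y' : state x w y -> K y' -> y = S i y' ->
  tripod K y' (phi S K i @` Qw w) -> state x (rcons w i) y'.
Proof.
move=> [xE Ky ty [s [ws sEQ sw slast]]] Ky' yE ty'; split=> //.
- by rewrite S_word_rcons -yE.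
- by rewrite phi_word_rcons.
exists (rcons s (EQ (Qw w) i (Qw (rcons w i)))); split.
- rewrite -cats1; apply/fin_walk_from_cat; split=> //; rewrite slast; split=> //.
  split; first exact: gt_vertexQ ty.
  split; last by rewrite phi_word_rcons.
  by apply: (@gt_vertexQ _ y'); rewrite phi_word_rcons.
- by move=> e /=; rewrite -cats1 => /List.in_app_iff[/sEQ//|[<-|]].
- by rewrite -cats1 pmap_cat sw cats1.
- by rewrite map_rcons last_rcons.
Qed.

Lemma tripod_proper x : tripod K x P -> gt_vertices S K (VQ P).
Proof. by rewrite -{1}phi_word_nil => /gt_vertexQ; rewrite phi_word_nil. Qed.

Lemma state_terminal (x : X) w y (e : gt_edge X m) : tripod K x P -> state x w y ->
  src e = VQ (Qw w) -> gt_edges S K e -> (forall e' : gt_edge X m, tgt e <> src e') ->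
  exists s, [/\ proper_walk S K (FinWalk (rcons s e)),
    edges_of (FinWalk s) `<=` @in_EQ R X m & x = S_word S (pmap (@gt_label R X m) s) y].
Proof.
move=> tx [xE Ky ty [s [ws sEQ sw slast]]] se ee dead; exists s; split=> //.
- split; first exact: tripod_proper tx.
  apply: maximal_dead_end => //; rewrite -cats1; apply/fin_walk_from_cat.
  by split=> //; rewrite slast.
- by rewrite sw.
Qed.

Lemma neighbours_hull (T : set (sprout_vertex (X := X))) b n :
  neighbours S K T (inr b) #>= `I_n ->
  neighbours S K (sprout_vertices S K) (inr b) #>= `I_n.
Proof.
move=> /card_le_trans; apply; apply: subset_card_le => -[i|c] [Tb Tu bu] //.
by split=> //; have /asboolP[] := bu.
Qed.

Lemma state_next x w y : tripod K x P -> state x w y ->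
  [\/ exists i y', y = S i y' /\ state x (rcons w i) y',
   exists s e, [/\ Omega_B S K (FinWalk (rcons s e)), gt_tgt e = VB y
        & x = S_word S (pmap (@gt_label R X m) s) y] |
   exists s e, [/\ Omega_P S K (FinWalk (rcons s e)), gt_tgt e = VP y
        & x = S_word S (pmap (@gt_label R X m) s) y]].
Proof.
move=> tx st; have [xE Ky ty _] := st.
have QP := @phi_word_sub w.
have [[i [y' [Ky' yE ty']]]|[by_ nQy deg]|[Qy deg]] :=
    tripod_cases S_inj S_cont K_eq dK finP Ky QP ty.
- by constructor 1; exists i, y'; split=> //; exact: (state_step st).
- constructor 2; pose e : gt_edge X m := EB (Qw w) y.
  have ee : gt_edges S K e.
    by split; [exact: gt_vertexQ ty|split=> //; split=> //; exact: neighbours_hull deg].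
  have [//|//||s [ps sEQ xs]] := @state_terminal x w y e tx st.
    by move=> [].
  by exists s, e; split=> //; split=> //; exists s, e.
- constructor 3; pose e : gt_edge X m := EP (Qw w) y.
  have ee : gt_edges S K e.
    split; [exact: gt_vertexQ ty|split=> //; split; [exact: QP|exact: neighbours_hull deg]].
  have [//|//||s [ps sEQ xs]] := @state_terminal x w y e tx st.
    by move=> [].
  by exists s, e; split=> //; split=> //; exists s, e.
Qed.

Lemma state_sequence x : K x -> tripod K x P ->
  (forall w y, state x w y -> exists i y', y = S i y' /\ state x (rcons w i) y') ->
  exists (alpha : nat -> 'I_m) (y : nat -> X),
    forall n, y n = S (alpha n) (y n.+1) /\ state x (mkseq alpha n) (y n).
Proof.
move=> Kx tx next; have s0 := state_nil Kx tx.
have /choice[F FP] : forall wy : seq 'I_m * X, exists iz : 'I_m * X,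
    state x wy.1 wy.2 -> wy.2 = S iz.1 iz.2 /\ state x (rcons wy.1 iz.1) iz.2.
  move=> [w y]; have [st|nst] := pselect (state x w y).
    by have [i [z ?]] := next _ _ st; exists (i, z).
  by have [i _] := next _ _ s0; exists (i, y).
pose g n := iter n (fun wy => (rcons wy.1 (F wy).1, (F wy).2)) ([::], x).
have gst n : state x (g n).1 (g n).2 by elim: n => //= n /FP[].
exists (fun n => (F (g n)).1), (fun n => (g n).2) => n; split.
  by have [] := FP _ (gst n).
suff -> : mkseq (fun n => (F (g n)).1) n = (g n).1 by [].
by elim: n => // n IHn; rewrite mkseqS IHn.
Qed.

(** The letters chosen in the descent need not be periodic although the sets Q_n repeat. So [beta]
    follows them up to the first repetition N and then repeats the cycle from n to N - 1; x keeps
    this address because the maps on the cycle are injective. *)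
Lemma tripod_periodic_walk x : K x -> tripod K x P ->
  (forall w y, state x w y -> exists i y', y = S i y' /\ state x (rcons w i) y') ->
  exists (f : nat -> gt_edge X m) (beta : nat -> 'I_m),
      [/\ Omega_Q S K (InfWalk f),
          path_then_cycle (@gt_src R X m) f,
          forall n, gt_label (f n) = Some (beta n),
          preperiodic beta
        & is_address S K beta x].
Proof.
move=> Kx tx /(state_sequence Kx tx)[alpha [y ayP]].
pose Q n := Qw (mkseq alpha n).
have QP n : Q n `<=` P by exact: phi_word_sub.
have QS n : phi S K (alpha n) @` Q n = Q n.+1 by rewrite /Q mkseqS phi_word_rcons.
have finQ n : finite_set (Q n) := sub_finite_set (@QP n) finP.
have [n [N [nN QnN Qinj]]] := first_repetition (finite_subsets_repeat finP QP).
have phi_inj := cycle_maps_injective finQ QS QnN.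
pose k := (N - n)%N; have k0 : (0 < k)%N by rewrite subn_gt0.
(* Runs through 0, ..., N - 1 and then cycles through n, ..., N - 1. *)
pose sg t := if (t < N)%N then t else (n + (t - n) %% k)%N.
have sgk t : (n <= t)%N -> sg (t + k)%N = sg t.
  move=> nt; have -> : sg (t + k)%N = (n + (t - n) %% k)%N.
    rewrite /sg ltnNge (_ : (N <= t + k)%N) /=; last by rewrite /k; lia.
    by rewrite -addnBAC// modnDr.
  rewrite /sg; case: ltnP => // tN; rewrite modn_small ?subnKC//.
  by rewrite /k; lia.
have sgN t : (sg t < N)%N.
  rewrite /sg; case: (ltnP t N) => // _; have := ltn_pmod (t - n) k0.
  by move: (_ %% k)%N => r; rewrite /k; lia.
have sgn t : (n <= t)%N -> (n <= sg t)%N.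
  by rewrite /sg; case: ifP => // _ _; exact: leq_addr.
have sgE t : (t < N)%N -> sg t = t by rewrite /sg => ->.
(* The only index at which [sg] does not simply advance is N - 1, where Q N = Q n closes the
   cycle. *)
have QsgS t : Q (sg t).+1 = Q (sg t.+1).
  have step u : (u < N)%N -> Q u.+1 = Q (sg u.+1).
    move=> uN; have [u1|u1] := ltnP u.+1 N; first by rewrite sgE.
    have -> : u.+1 = N by apply/eqP; rewrite eqn_leq uN.
    have -> : N = (n + k)%N by rewrite /k; lia.
    by rewrite sgk// sgE// /k subnKC ?QnN// ltnW.
  have [tn|nt] := ltnP t n; first by rewrite sgE ?step// (ltn_trans tn).
  have -> : sg t.+1 = sg (sg t).+1.
    rewrite -(subnKC nt); elim/ltn_ind: (t - n)%N => r IHr.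
    have [rk|kr] := ltnP r k.
      by rewrite [sg (n + r)%N]sgE//; move: rk; rewrite /k; lia.
    have <- : (n + (r - k) + k = n + r)%N by lia.
    rewrite -addSn !sgk ?leq_addr//; last by lia.
    by apply: IHr; lia.
  exact: step.
pose beta t := alpha (sg t).
pose f t := EQ (Q (sg t)) (beta t) (Q (sg t).+1).
have tQ t : tripod K (y t) (Q t) by have [_ []] := ayP t.
have vQ t : gt_vertices S K (VQ (Q t)) := gt_vertexQ (tQ t).
have Q0 : Q 0%N = P by exact: phi_word_nil.
have N0 : (0 < N)%N by exact: leq_ltn_trans nN.
exists f, beta; split=> //.
- split.
    split; first exact: tripod_proper tx.
    split; last by move=> [//|g] _ /= ->.
    split; first by rewrite /= sgE// Q0.
    move=> t; split; last by rewrite /= QsgS.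
    by split; [exact: vQ|split; [exact: vQ|exact: QS]].
  by move=> _ [t _ <-].
- exists n, k; split=> //.
  + by move=> t nt; rewrite /f /beta sgk.
  + move=> a b /set_mem/= an /set_mem/= bn; rewrite !sgE; [|lia|lia].
    by move=> [E]; apply: Qinj => //; apply: mem_set => /=; lia.
  + move=> a b /set_mem/= an /set_mem/= bn; rewrite !sgE; [|lia|lia].
    by move=> [E]; apply: Qinj => //; apply: mem_set => /=; lia.
- by exists n, k; split=> // t nt; rewrite /beta sgk.
apply: (address_of_cells S_contr K_attr) => t.
(* Up to time n the remaining point is [y t]. Later it may differ, since it is produced by
   [tripod_inj_step] for the letters of the cycle. *)
have [z [Kz tz xE _]] : exists z, [/\ K z, tripod K z (Q (sg t)),
    x = S_word S (mkseq beta t) z & (t <= n)%N -> z = y t].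
  elim: t => [|t [z [Kz tz xE zy]]].
    exists x; rewrite sgE// Q0; split=> // _.
    by have [_ [-> _ _ _]] := ayP 0%N.
  have [tn|nt] := ltnP t n.
    have [yE _] := ayP t; have [_ [_ Ky' _ _]] := ayP t.+1.
    exists (y t.+1); split=> //.
    - by rewrite sgE//; exact: leq_ltn_trans nN.
    - by rewrite mkseqS S_word_rcons /beta sgE ?(ltn_trans tn)// -yE -zy// ltnW.
  have sgt : (n <= sg t < N)%N by rewrite sgn ?sgN.
  have [z' [Kz' zE tz']] := tripod_inj_step S_inj S_cont K_eq dK finP Kz (@QP _) tz (phi_inj _ sgt).
  exists z'; split=> //.
  - by rewrite -QsgS -QS.
  - by rewrite mkseqS S_word_rcons -zE.
by exists z.
Qed.

(** The bound n.+2 covers both degree 3 in V_B and degree 2 in V_P. *)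
Lemma vertex_two_cells b n : neighbours S K (sprout_vertices S K) (inr b) #>= `I_n.+2 ->
  exists i j, [/\ i != j, (S i @` K) b & (S j @` K) b].
Proof.
move=> dn.
have /card_ge2P[u [v [[_ _ bu] [_ _ bv] uv]]] :
    neighbours S K (sprout_vertices S K) (inr b) #>= `I_2.
  by apply: card_le_trans dn; rewrite card_le_II.
case: u v bu bv uv => [i|?] [j|?] //= /asboolP[_ Kib] /asboolP[_ Kjb] ij.
by exists i, j; split=> //; apply/eqP => E; apply: ij; rewrite E.
Qed.

Lemma proper_last_edge s e : proper_walk S K (FinWalk (rcons s e)) -> gt_edges S K e.
Proof.
by move=> [_ [+ _]]; rewrite /= -cats1 => /fin_walk_from_cat[_ []].
Qed.

End transformation_graph.

Theorem theorem6p14 (R : realType) (X : completeMetricType R) (m : nat)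
    (S : 'I_m -> X -> X) (K : set X)
    (S_inj : forall i, injective (S i))
    (S_contr : forall i, contractive (S i))
    (K_attr : is_attractor S K)
    (K_dendrite : dendrite K)
    (P_finite : finite_set (boundary S K))
    (Gamma_regular : sprout_regular S K)
    (x : X)
    (x_ram : ramification_point (main_tree S K) x)
    (x_notin : ~ (black S K `|` boundary S K) x) :
  let cond1 :=
    exists (f : nat -> gt_edge X m) (beta : nat -> 'I_m),
      [/\ Omega_Q S K (InfWalk f),
          path_then_cycle (@gt_src R X m) f,
          forall n, gt_label (f n) = Some (beta n),
          preperiodic beta
        & is_address S K beta x] in
  let cond2 :=
    exists (s : seq (gt_edge X m)) (e : gt_edge X m) (b : X),
      [/\ Omega_B S K (FinWalk (rcons s e)),
          gt_tgt e = VB b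
        & x = S_word S (pmap (@gt_label R X m) s) b] in
  let cond3 :=
    exists (s : seq (gt_edge X m)) (e : gt_edge X m) (p : X),
      [/\ Omega_P S K (FinWalk (rcons s e)),
          gt_tgt e = VP p
        & x = S_word S (pmap (@gt_label R X m) s) p] in
  (cond1 \/ cond2 \/ cond3) /\
  ((exists! alpha : nat -> 'I_m, is_address S K alpha x) ->
   [/\ cond1, ~ cond2 & ~ cond3]).
Proof.
move=> cond1 cond2 cond3.
have PK : boundary S K `<=` K by move=> p [].
have nPx : ~ boundary S K x by move=> Px; apply: x_notin; right.
have [p1 [p2 [p3 [[P1 P2 P3] [[p12 p13 p23] [s12 s13 s23]]]]]] :=
  main_tree_sep K_dendrite PK P_finite nPx x_ram.
have sepC a b : sep K x a b -> sep K x b a by move=> sab A pA AK Ab Aa; exact: sab.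
have tx : tripod K x (boundary S K).
  exists (fun a : 'I_3 => match val a with 0 => p1 | 1 => p2 | _ => p3 end).
  split.
  - by move=> [[|[|[|]]] ?].
  - by move=> [[|[|[|a]]] ha] [[|[|[|b]]] hb] //= E; apply: val_inj => //=;
      solve [by case: p12|by case: p13|by case: p23].
  - by move=> [[|[|[|a]]] ha] [[|[|[|b]]] hb] //= _; solve [exact: s12|exact: s13|exact: s23|exact: sepC].
have Kx : K x.
  have [Hx _] := x_ram; exact: (Hx K (conj (conj K_dendrite (@subset_refl _ _)) PK)).
have main : cond1 \/ cond2 \/ cond3.
  (* If neither 2) nor 3) holds, every state of the descent has a successor. *)
  apply: contrapT => /not_orP[n1 /not_orP[n2 n3]]; apply: n1.
  apply: tripod_periodic_walk => // w y st.
  have [//|[s [e ?]]|[s [e ?]]] := state_next S_inj S_contr K_attr K_dendrite P_finite tx st.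
    by case: n2; exists s, e, y.
  by case: n3; exists s, e, y.
split=> // uniq_x.
(* The end vertex of the walk lies in two cells, so its image x has two addresses; the same argument
   excludes 3). *)
have n2 : ~ cond2.
  move=> [s [e [b [[pw _] te xE]]]].
  have [_ [+ _]] := proper_last_edge pw; rewrite te => -[_ /vertex_two_cells[i [j [ij Kib Kjb]]]].
  by have := two_addresses S_contr K_attr (w := pmap (@gt_label R X m) s) ij Kib Kjb; rewrite -xE.
have n3 : ~ cond3.
  move=> [s [e [b [[pw _] te xE]]]].
  have [_ [+ _]] := proper_last_edge pw; rewrite te => -[_ /vertex_two_cells[i [j [ij Kib Kjb]]]].
  by have := two_addresses S_contr K_attr (w := pmap (@gt_label R X m) s) ij Kib Kjb; rewrite -xE.
by split=> //; case: main => // -[].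
Qed.
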